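(* Consider the infinite-horizon version of Problem P2. For a fixed policy $\Gamma^1$ for O1, an optimal policy for O2 is of the form $$U^2_t=\begin{cases}1&\text{if } \pi^2_t\le\alpha_t(Z^1_{1:t})\\ N&\text{if } \alpha_t(Z^1_{1:t})<\pi^2_t<\beta_t(Z^1_{1:t})\\ 0&\text{if } \pi^2_t\ge\beta_t(Z^1_{1:t})\end{cases}$$ where $0\le\alpha_t(Z^1_{1:t})\le\beta_t(Z^1_{1:t})\le1$ are thresholds that depend on the sequence of messages $Z^1_{1:t}$ received from O1.
   Context: **Model.** $H\in\{0,1\}$ is random with known prior $P(H=0)=p_0$, $P(H=1)=1-p_0$. There are two observers O1, O2. $Y^i_t\in\mathcal{Y}^i$ is the observation of O$i$ at time $t=1,2,\dots$; given $H$, it has either a discrete distribution $P^i_t(\cdot|H)$ or a density $f^i_t(\cdot|H)$. Given $H$, the observations of each observer at different times are independent, and the two observation sequences are independent. $X_{1:t}$ denotes $X_1,\dots,X_t$; $b$ is a blank message (no transmission). **O1.** As long as it has not sent a final message, at time $t$ O1 chooses $Z^1_t=\gamma^1_t(Y^1_{1:t})\in\{0,1,b\}$; $\tau^1=\min\{t: Z^1_t\in\{0,1\}\}$. It sends nothing afterwards and gets no feedback from O2. **Infinite-horizon Problem P2.** O2 takes measurements from time $t=1$; at each time $t$, after O1's action at time $t$, O2 (if not stopped) chooses $U^2_t=\gamma^2_t(Y^2_{1:t},Z^1_{1:t})\in\{0,1,N\}$ ($N$ = continue), where for $t>\tau^1$ the sequence $Z^1_{1:t}$ means $Z^1_{1:\tau^1}$;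 $\tau^2=\min\{t:U^2_t\in\{0,1\}\}$. O2 may stop before O1 does. $\tau^1,\tau^2$ need not be bounded. The objective is to minimize $\mathbb{E}^{\Gamma^1,\Gamma^2}\{c^1\tau^1+c^2\tau^2+J(U^2_{\tau^2},H)\}$ over $\Gamma^1=(\gamma^1_1,\gamma^1_2,\dots)$, $\Gamma^2=(\gamma^2_1,\gamma^2_2,\dots)$, where $c^1,c^2$ are finite positive numbers, $0\le J\le L<\infty$, $J(0,1)>J(1,1)$, $J(1,0)>J(0,0)$. Attention is restricted to policies for which $\mathbb{E}\tau^1$ and $\mathbb{E}\tau^2$ are finite (otherwise the cost is infinite). **O2's belief.** For fixed $\Gamma^1$, $\pi^2_t=P^{\Gamma^1}(H=0|Y^2_{1:t},Z^1_{1:t})$. ''Optimal'' means minimizing the cost $\mathbb{E}^{\Gamma^1,\Gamma^2}\{c^1\tau^1+c^2\tau^2+J(U^2_{\tau^2},H)\}$ over $\Gamma^2$ for the given $\Gamma^1$. If $\alpha_t=\beta_t=\pi^2_t$, the first listed applicable case is used. *)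

(* Defs.v *)
From HB Require Import structures.
From mathcomp Require Import all_boot all_order all_algebra.
From mathcomp Require Import all_classical all_reals all_analysis.

Set Implicit Arguments.
Unset Strict Implicit.
Unset Printing Implicit Defensive.

Import Order.TTheory GRing.Theory Num.Theory.
Local Open Scope classical_set_scope.
Local Open Scope ring_scope.

(* Conventions.  H takes the value [false] for 0 and [true] for 1.  Messages of
   O1 and actions of O2 live in [option bool]: [Some false] and [Some true] are
   0 and 1, and [None] is the blank message b of O1, resp. the action N
   (continue) of O2.  Time runs over t >= 1; index 0 of a sequence is unused. *)

Definition cprob d (T : measurableType d) (R : realType) (P : probability T R)
    (E F : set T) : R :=
  fine (P (E `&` F)) / fine (P F).

(* The reference measure [mu t] is a counting measure on a countable support
   when Y_t has a discrete distribution (and [f t h] is then its mass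
   function). *)
Definition has_cond_density d (T : measurableType d) (R : realType)
    (P : probability T R) (H : {RV P >-> bool})
    dY (S : measurableType dY) (Y : nat -> {RV P >-> S})
    (mu : nat -> {sigma_finite_measure set S -> \bar R})
    (f : nat -> bool -> S -> R) : Prop :=
  forall t h, (0 < t)%N ->
    [/\ measurable_fun setT (f t h),
        forall y, 0 <= f t h y,
        (\int[mu t]_y (f t h y)%:E = 1)%E
      & P (H @^-1` [set h]) != 0%E -> forall A, measurable A ->
          ((cprob P (Y t @^-1` A) (H @^-1` [set h]))%:E =
           \int[mu t]_(y in A) (f t h y)%:E)%E].

Definition cond_indep_over_time d (T : measurableType d) (R : realType)
    (P : probability T R) (H : {RV P >-> bool})
    dY (S : measurableType dY) (Y : nat -> {RV P >-> S}) : Prop :=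
  forall h, P (H @^-1` [set h]) != 0%E ->
  forall n (A : nat -> set S), (forall t, measurable (A t)) ->
    cprob P (\bigcap_(t in [set t | (1 <= t <= n)%N]) (Y t @^-1` A t))
            (H @^-1` [set h])
    = \prod_(1 <= t < n.+1) cprob P (Y t @^-1` A t) (H @^-1` [set h]).

Definition hist T S (Y : nat -> T -> S) (t : nat) (w : T) : t.-tuple S :=
  [tuple Y i.+1 w | i < t].

Definition cond_indep_seqs d (T : measurableType d) (R : realType)
    (P : probability T R) (H : {RV P >-> bool})
    d1 (S1 : measurableType d1) (Y1 : nat -> {RV P >-> S1})
    d2 (S2 : measurableType d2) (Y2 : nat -> {RV P >-> S2}) : Prop :=
  forall h, P (H @^-1` [set h]) != 0%E ->
  forall n (A1 : set (n.-tuple S1)) (A2 : set (n.-tuple S2)),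
    measurable A1 -> measurable A2 ->
    cprob P (hist Y1 n @^-1` A1 `&` hist Y2 n @^-1` A2) (H @^-1` [set h])
    = cprob P (hist Y1 n @^-1` A1) (H @^-1` [set h]) *
      cprob P (hist Y2 n @^-1` A2) (H @^-1` [set h]).

(* [first_time U] is min {t >= 1 : U t is 0 or 1}, with [None] for +oo. *)
Definition first_time (U : nat -> option bool) : option nat :=
  if pselect (exists t, (0 < t)%N && isSome (U t)) is left h
  then Some (ex_minn h) else None.

Definition time_val (R : realType) (tau : option nat) : \bar R :=
  (if tau is Some t then t%:R%:E else +oo)%E.

Definition policy1 S1 := forall t : nat, t.-tuple S1 -> option bool.

Definition policy2 S2 :=
  forall t : nat, t.-tuple S2 -> seq (option bool) -> option bool.

Definition measurable_policy1 d1 (S1 : measurableType d1) (g1 : policy1 S1) :=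
  forall t (z : option bool), (0 < t)%N -> measurable [set y | g1 t y = z].

Definition measurable_policy2 d2 (S2 : measurableType d2) (g2 : policy2 S2) :=
  forall t (z : seq (option bool)) (u : option bool), (0 < t)%N ->
    measurable [set y | g2 t y z = u].

Section dynamics.
Context {T S1 S2 : Type} (Y1 : nat -> T -> S1) (Y2 : nat -> T -> S2).

Definition msg (g1 : policy1 S1) t (w : T) : option bool := g1 t (hist Y1 t w).

Definition tau1 (g1 : policy1 S1) (w : T) : option nat :=
  first_time (fun t => msg g1 t w).

(* Z^1_{1:t}, cut at tau^1 *)
Definition msgs (g1 : policy1 S1) t (w : T) : seq (option bool) :=
  [seq msg g1 s w | s <- iota 1 t & oapp (leq s) true (tau1 g1 w)].

Definition act2 (g1 : policy1 S1) (g2 : policy2 S2) t (w : T) : option bool :=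
  g2 t (hist Y2 t w) (msgs g1 t w).

Definition tau2 (g1 : policy1 S1) (g2 : policy2 S2) (w : T) : option nat :=
  first_time (fun t => act2 g1 g2 t w).

(* J (U^2_{tau^2}, h); the value 0 on {tau^2 = +oo} is a dummy, as the total
   cost is +oo there. *)
Definition terminal_cost (R : realType) (J : bool -> bool -> R)
    (g1 : policy1 S1) (g2 : policy2 S2) (h : bool) (w : T) : R :=
  if tau2 g1 g2 w is Some t
  then oapp (fun u => J u h) 0 (act2 g1 g2 t w) else 0.

End dynamics.

Definition cost d (T : measurableType d) (R : realType) (P : probability T R)
    (H : T -> bool) S1 S2 (Y1 : nat -> T -> S1) (Y2 : nat -> T -> S2)
    (c1 c2 : R) (J : bool -> bool -> R)
    (g1 : policy1 S1) (g2 : policy2 S2) : \bar R :=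
  (\int[P]_w (c1%:E * time_val R (tau1 Y1 g1 w)
              + c2%:E * time_val R (tau2 Y1 Y2 g1 g2 w)
              + (terminal_cost Y1 Y2 J g1 g2 (H w) w)%:E))%E.

Definition admissible1 d (T : measurableType d) (R : realType)
    (P : probability T R) d1 (S1 : measurableType d1) (Y1 : nat -> T -> S1)
    (g1 : policy1 S1) : Prop :=
  measurable_policy1 g1 /\
  (\int[P]_w time_val R (tau1 Y1 g1 w) < +oo)%E.

Definition admissible2 d (T : measurableType d) (R : realType)
    (P : probability T R) S1 d2 (S2 : measurableType d2)
    (Y1 : nat -> T -> S1) (Y2 : nat -> T -> S2)
    (g1 : policy1 S1) (g2 : policy2 S2) : Prop :=
  measurable_policy2 g2 /\
  (\int[P]_w time_val R (tau2 Y1 Y2 g1 g2 w) < +oo)%E.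

Definition optimal2 d (T : measurableType d) (R : realType)
    (P : probability T R) (H : T -> bool)
    S1 d2 (S2 : measurableType d2)
    (Y1 : nat -> T -> S1) (Y2 : nat -> T -> S2)
    (c1 c2 : R) (J : bool -> bool -> R)
    (g1 : policy1 S1) (g2 : policy2 S2) : Prop :=
  admissible2 P Y1 Y2 g1 g2 /\
  forall g2', admissible2 P Y1 Y2 g1 g2' ->
    (cost P H Y1 Y2 c1 c2 J g1 g2 <= cost P H Y1 Y2 c1 c2 J g1 g2')%E.

(* [pi2 t (hist Y2 t w) (msgs Y1 g1 t w)] is a version of
   P(H = 0 | Y^2_{1:t}, Z^1_{1:t}).  There are countably many values of
   Z^1_{1:t}, so the events {Y^2_{1:t} \in A, Z^1_{1:t} = z} suffice to
   characterize the conditional probability. *)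
Definition is_belief2 d (T : measurableType d) (R : realType)
    (P : probability T R) (H : T -> bool)
    S1 d2 (S2 : measurableType d2)
    (Y1 : nat -> T -> S1) (Y2 : nat -> T -> S2) (g1 : policy1 S1)
    (pi2 : forall t : nat, t.-tuple S2 -> seq (option bool) -> R) : Prop :=
  forall t, (0 < t)%N -> forall z,
    measurable_fun setT (fun y : t.-tuple S2 => pi2 t y z) /\
    forall A : set (t.-tuple S2), measurable A ->
      let B := hist Y2 t @^-1` A `&` msgs Y1 g1 t @^-1` [set z] in
      P (H @^-1` [set false] `&` B)
      = (\int[P]_(w in B) (pi2 t (hist Y2 t w) (msgs Y1 g1 t w))%:E)%E.

Definition threshold_policy2 (R : realType) S2
    (alpha beta : nat -> seq (option bool) -> R)
    (pi2 : forall t : nat, t.-tuple S2 -> seq (option bool) -> R) :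
    policy2 S2 :=
  fun t y z =>
    if pi2 t y z <= alpha t z then Some true
    else if pi2 t y z < beta t z then None
    else Some false.

(* Main.v *)
Require Import Defs.
From HB Require Import structures.
From mathcomp Require Import all_boot all_order all_algebra.
From mathcomp Require Import all_classical all_reals all_analysis.
From mathcomp Require Import measurable_realfun.
From mathcomp Require Import ring lra.

(** Fix the policy of O1 and write z for the messages received up to time t.
Given H, the observations of O2 are independent of z, so all that O2 knows
about H is carried by the two masses a and b, the joint densities of
(H = 0, z, observations) and (H = 1, z, observations).  One time step multiplies
a and b by the conditional probability of the new message and by the density of
the new observation, and every cost is homogeneous of degree one in (a, b).
Hence an optimal decision depends on z and on the belief a / (a + b) only.

Thresholds.  Stopping with a given action costs a linear function of (a, b).
The Bellman operator preserves homogeneous superadditive functions, that is, in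
terms of the belief, concave ones; so the optimal cost [horizon_value] with n
further steps and its infimum [value] over n are of this kind.  The beliefs at
which one action costs no more than the other action and than continuing are
those where a linear function lies below a concave one.  They form an interval,
which contains the end point where that action is the right one
([threshold_one_side], [optimal_thresholds]).

Optimality.  By monotonicity alone, [value] is at least the Bellman operator applied
to itself ([bellman_value_le]).  A policy that is forced to stop at time n + 1 costs
at least the value with horizon n, hence at least [value]; forcing it costs at most
L P(tau^2 > n + 1), which vanishes in the limit when tau^2 has finite mean
([value_le_policy_cost]).  For the threshold policy [bellman_value_le] telescopes over
time, and the expected cost of any number of steps stays below [value]; this bounds
its cost and, since every step costs c^2 > 0, the mean of its stopping time
([policy_cost_le_value]).

Probability.  [joint_law] writes the joint law of H, the messages and the
observations through densities with respect to one product reference measure on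
tuples.  It turns the one-step identity [integral_cont_cost] into Tonelli's
theorem, exhibits a / (a + b) as a belief ([is_belief_bayes]), and shows that every
other version of the belief agrees with it outside a null set ([belief_unique]);
this is why thresholds chosen once serve all versions. *)

Set Implicit Arguments.
Unset Strict Implicit.
Unset Printing Implicit Defensive.

Import Order.TTheory GRing.Theory Num.Theory.
Local Open Scope classical_set_scope.
Local Open Scope ring_scope.

(** * Costs that are homogeneous and concave in the posterior masses *)

Section thresholds.
Context {R : realType}.
Implicit Types (W : R -> R -> \bar R) (a b p q : R).

(** In terms of the belief a / (a + b): concave.  In this form the property is
obviously stable under minima, sums and integrals. *)
Definition superlinear_cost W := [/\ forall a b, (0 <= W a b)%E,
  forall (k : R) a b, 0 <= k -> 0 <= a -> 0 <= b ->
    W (k * a) (k * b) = (k%:E * W a b)%E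
  & forall a a' b b', 0 <= a -> 0 <= a' -> 0 <= b -> 0 <= b' ->
    (W a b + W a' b' <= W (a + a')%R (b + b')%R)%E].

Lemma superlinear_cost_le W a b a' b' : superlinear_cost W ->
  0 <= a <= a' -> 0 <= b <= b' -> (W a b <= W a' b')%E.
Proof.
move=> [W0 _ Wadd] /andP[a0 aa'] /andP[b0 bb'].
have -> : a' = a + (a' - a) by lra.
have -> : b' = b + (b' - b) by lra.
apply: le_trans (Wadd _ _ _ _ _ _ _ _) => //.
- by rewrite leeDl.
- by rewrite subr_ge0.
- by rewrite subr_ge0.
Qed.

(** The set S of beliefs where the linear cost is at most W contains 0 by the last
hypothesis, and it is an interval by concavity.  The upper bound on W keeps S away
from 1; a concave function is continuous except possibly at the end points, so S
contains its supremum. *)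
Lemma threshold_one_side W p q p0 q0 :
  superlinear_cost W -> 0 <= p0 < p -> 0 <= q < q0 ->
  (forall a b, 0 <= a -> 0 <= b -> (W a b <= (a * p0 + b * q0)%:E)%E) ->
  (q%:E <= W 0%R 1%R)%E ->
  exists2 alpha : R, 0 <= alpha < 1 & forall a b, 0 <= a -> 0 <= b -> 0 < a + b ->
    ((a * p + b * q)%:E <= W a b)%E <-> a / (a + b) <= alpha.
Proof.
move=> sW /andP[p00 p0p] /andP[q00 qq0] Wle q1.
have [W0 Whom Wadd] := sW.
have Wfin a b : 0 <= a -> 0 <= b -> exists w, W a b = w%:E.
  move=> a0 b0; have := Wle _ _ a0 b0; have := W0 a b.
  by case: (W a b) => // w _ _; exists w.
pose S := [set a : R | 0 <= a <= 1 /\ ((a * p + (1 - a) * q)%:E <= W a (1 - a)%R)%E].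
(* the belief at which the linear cost meets the upper bound of W *)
pose kappa := (q0 - q) / ((p - p0) + (q0 - q)).
have den0 : 0 < (p - p0) + (q0 - q) by lra.
have kappa1 : kappa < 1 by rewrite /kappa ltr_pdivrMr //; lra.
have Skappa a : S a -> a <= kappa.
  move=> [/andP[a0 a1]] /le_trans /(_ (Wle _ _ a0 _)).
  rewrite subr_ge0 => /(_ a1); rewrite lee_fin => h.
  by rewrite /kappa ler_pdivlMr //; nra.
have S0 : S 0.
  split; first by rewrite lexx ler01.
  by rewrite mul0r add0r subr0 mul1r.
have Shas : has_sup S.
  by split; [exists 0|exists kappa => a /Skappa].
pose al := sup S.
have al0 : 0 <= al by apply: ub_le_sup => //; exact: Shas.2.
have al1 : al < 1.
  by apply: le_lt_trans kappa1; apply: ge_sup; [exists 0|move=> a /Skappa].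
have scale a b : 0 <= a -> 0 <= b -> 0 < a + b ->
    ((a * p + b * q)%:E <= W a b)%E <-> S (a / (a + b)).
  move=> a0 b0 ab0; have abN : a + b != 0 by rewrite gt_eqF.
  have bE : 1 - a / (a + b) = b / (a + b) by field.
  have r0 : 0 <= a / (a + b) <= 1.
    by rewrite divr_ge0 ?(ltW ab0) //= ler_pdivrMr // mul1r lerDl.
  rewrite /S /= bE.
  have -> : a / (a + b) * p + b / (a + b) * q = (a + b)^-1 * (a * p + b * q).
    by field.
  have i0 : 0 < (a + b)^-1 by rewrite invr_gt0.
  have -> : W (a / (a + b)) (b / (a + b)) = ((a + b)^-1%:E * W a b)%E.
    by rewrite -Whom ?(ltW i0) // ![_^-1 * _]mulrC.
  rewrite EFinM lee_pmul2l //.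
  by split => [h|[]//]; split.
have Sal : S al.
  split; first by rewrite al0 ltW.
  have oal0 : 0 <= 1 - al by rewrite subr_ge0 ltW.
  have [w wE] := Wfin _ _ al0 oal0.
  rewrite wE lee_fin leNgt; apply/negP => wlt.
  pose K := `|w + (1 - al) * (p - q)| + 1.
  have K0 : 0 < K by rewrite ltr_wpDl.
  pose del := (1 - al) * (al * p + (1 - al) * q - w).
  have del0 : 0 < del by rewrite mulr_gt0 // subr_gt0.
  have /(sup_adherent) /(_ Shas) [s Ss sal] : 0 < del / K by rewrite divr_gt0.
  have s_al : s <= al by apply: ub_le_sup => //; exact: Shas.2.
  have [/andP[s0 s1] Ws] := Ss.
  have s1' : s < 1 by apply: le_lt_trans al1.
  (* (al, 1 - al) dominates a multiple of (s, 1 - s), and W is monotone *)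
  have : (((1 - al) / (1 - s))%:E * W s (1 - s)%R <= W al (1 - al)%R)%E.
    rewrite -Whom //; [|by rewrite divr_ge0 // subr_ge0|by rewrite subr_ge0].
    apply: superlinear_cost_le => //.
      apply/andP; split; first by rewrite mulr_ge0 // divr_ge0 // subr_ge0.
      by rewrite mulrAC ler_pdivrMr ?subr_gt0 //; nra.
    by rewrite -mulrA mulVf ?mulr1 ?lexx ?oal0 // subr_eq0 gt_eqF.
  rewrite wE => h.
  have {h Ws} : (((1 - al) / (1 - s))%:E * (s * p + (1 - s) * q)%:E <= w%:E)%E.
    apply: le_trans h; apply: lee_wpmul2l => //.
    by rewrite lee_fin divr_ge0 // subr_ge0.
  rewrite -EFinM lee_fin mulrAC ler_pdivrMr ?subr_gt0 // => h.
  have Kw : w + (1 - al) * (p - q) <= K - 1 by rewrite /K addrK ler_norm.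
  have : al - s < del / K by rewrite ltrBlDl -ltrBlDr.
  rewrite ltr_pdivlMr // => h2.
  have : (al - s) * (w + (1 - al) * (p - q)) <= (al - s) * K.
    by rewrite ler_wpM2l ?subr_ge0 //; lra.
  by move: h2; rewrite /del; clearbody K; lra.
exists al; first by rewrite al0.
move=> a b a0 b0 ab0; rewrite scale //; split => [h|h].
  by apply: ub_le_sup => //; exact: Shas.2.
have [/andP[_ _] Wal] := Sal.
have abN : a + b != 0 by rewrite gt_eqF.
set r := a / (a + b) in h *.
have r0 : 0 <= r <= 1.
  by rewrite divr_ge0 ?(ltW ab0) //= ler_pdivrMr // mul1r lerDl.
split => //; case/andP: r0 => r0 r1.
have [al00|] := eqVneq al 0.
  have -> : r = 0 by apply/eqP; rewrite eq_le r0 -al00 h.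
  by case: S0.
move=> alN0; have al_gt0 : 0 < al by rewrite lt_def alN0.
(* r lies between 0 and al, both in S: write it as a convex combination *)
pose th := r / al.
have th0 : 0 <= th by rewrite divr_ge0.
have th1 : th <= 1 by rewrite ler_pdivrMr // mul1r.
have -> : W r (1 - r) = W (th * al + (1 - th) * 0) (th * (1 - al) + (1 - th) * 1).
  by congr (W _ _); rewrite /th; field.
have oth0 : 0 <= 1 - th by rewrite subr_ge0.
have oal0 : 0 <= 1 - al by rewrite subr_ge0 ltW.
apply: le_trans (Wadd _ _ _ _ _ _ _ _); [|exact: mulr_ge0..].
rewrite !Whom //.
have -> : r * p + (1 - r) * q = th * (al * p + (1 - al) * q) + (1 - th) * q.
  by rewrite /th; field.
rewrite EFinD !EFinM; apply: leeD; apply: lee_wpmul2l => //.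
Qed.

Lemma superlinear_mine W W' : superlinear_cost W -> superlinear_cost W' ->
  superlinear_cost (fun a b => mine (W a b) (W' a b)).
Proof.
move=> [W0 Whom Wadd] [W'0 W'hom W'add]; split => [a b|k a b k0 a0 b0|].
- by rewrite le_min W0 W'0.
- by rewrite Whom // W'hom // mineMr.
- move=> a a' b b' a0 a'0 b0 b'0; rewrite le_min; apply/andP; split.
    by apply: le_trans (Wadd _ _ _ _ _ _ _ _) => //; apply: leeD;
      rewrite ge_min lexx.
  by apply: le_trans (W'add _ _ _ _ _ _ _ _) => //; apply: leeD;
    rewrite ge_min lexx orbT.
Qed.

Lemma superlinear_swap W : superlinear_cost W -> superlinear_cost (fun a b => W b a).
Proof.
move=> [W0 Whom Wadd]; split => //.
- by move=> k a b k0 a0 b0; rewrite Whom.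
- by move=> a a' b b' a0 a'0 b0 b'0; rewrite Wadd.
Qed.

(** Absolute values make the cost nonnegative on the whole plane, as integrands of
Tonelli's theorem must be; on the quadrant a, b >= 0 it is linear. *)
Definition stop_cost (J : bool -> bool -> R) u a b : \bar R :=
  (`|a| * J u false + `|b| * J u true)%:E.

Lemma stop_costE J u a b : 0 <= a -> 0 <= b ->
  stop_cost J u a b = (a * J u false + b * J u true)%:E.
Proof. by move=> a0 b0; rewrite /stop_cost !ger0_norm. Qed.

Definition best_stop J a b : \bar R :=
  mine (stop_cost J false a b) (stop_cost J true a b).

Lemma superlinear_stop J u : (forall u h, 0 <= J u h) ->
  superlinear_cost (stop_cost J u).
Proof.
move=> J0; split.
- by move=> a b; rewrite lee_fin addr_ge0 // mulr_ge0.
- move=> k a b k0 a0 b0; rewrite !stop_costE ?mulr_ge0 // -EFinM.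
  by congr EFin; ring.
- move=> a a' b b' a0 a'0 b0 b'0; rewrite !stop_costE ?addr_ge0 // -EFinD.
  by rewrite lee_fin le_eqVlt; apply/orP; left; apply/eqP; ring.
Qed.

(** [threshold_one_side] is applied twice: to action 1 against the minimum of
action 0 and W, and, with the roles of H = 0 and H = 1 exchanged,
to action 0. *)
Lemma optimal_thresholds J W :
  (forall u h, 0 <= J u h) ->
  J true true < J false true -> J false false < J true false ->
  superlinear_cost W ->
  (stop_cost J true 0 1 <= W 0%R 1%R)%E -> (stop_cost J false 1 0 <= W 1%R 0%R)%E ->
  exists alpha beta : R, 0 <= alpha /\ alpha <= beta /\ beta <= 1 /\
    forall a b, 0 <= a -> 0 <= b -> 0 < a + b ->
    ((if (a / (a + b) <= alpha)%R then stop_cost J true a b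
      else if (a / (a + b) < beta)%R then W a b else stop_cost J false a b)
     <= mine (best_stop J a b) (W a b))%E.
Proof.
move=> J0 J1 J2 sW W01 W10.
pose W1 a b := mine (stop_cost J false a b) (W a b).
pose W2 b a := mine (stop_cost J true a b) (W a b).
have [al /andP[al0 al1] alP] : exists2 alpha : R, 0 <= alpha < 1 &
    forall a b, 0 <= a -> 0 <= b -> 0 < a + b ->
    (stop_cost J true a b <= W1 a b)%E <-> a / (a + b) <= alpha.
  have [|||||al al01 alP] := @threshold_one_side W1 (J true false) (J true true)
      (J false false) (J false true).
  - by apply: superlinear_mine => //; exact: superlinear_stop.
  - by rewrite J0.
  - by rewrite J0.
  - by move=> a b a0 b0; rewrite -stop_costE // ge_min lexx.
  - rewrite le_min stop_costE // lee_fin !mul0r !mul1r !add0r ltW //=.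
    by move: W01; rewrite stop_costE // mul0r mul1r add0r.
  by exists al => // a b a0 b0 ab0; rewrite stop_costE //; exact: alP.
have [be /andP[be0 be1] beP] : exists2 beta : R, 0 <= beta < 1 &
    forall a b, 0 <= a -> 0 <= b -> 0 < b + a ->
    (stop_cost J false a b <= W2 b a)%E <-> b / (b + a) <= beta.
  have [|||||be be01 beP] := @threshold_one_side W2 (J false true) (J false false)
      (J true true) (J true false).
  - by apply: (@superlinear_swap (fun a b => mine _ _)); apply: superlinear_mine => //;
       exact: superlinear_stop.
  - by rewrite J0.
  - by rewrite J0.
  - by move=> b a b0 a0; rewrite addrC -stop_costE // ge_min lexx.
  - rewrite le_min stop_costE // lee_fin !mul0r !mul1r !addr0 ltW //=.
    by move: W10; rewrite stop_costE // mul0r mul1r addr0.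
  by exists be => // a b a0 b0 ab0; rewrite stop_costE // addrC; exact: beP.
(* between the thresholds both actions would be equally costly, while the
   difference of their costs is strictly monotone in the belief *)
have albe : al <= 1 - be.
  rewrite leNgt; apply/negP => lt.
  have : (stop_cost J true al (1 - al) <= W1 al (1 - al)%R)%E.
    by apply/alP; rewrite ?subr_ge0 ?(ltW al1) // subrKC ?divr1.
  have : (stop_cost J false (1 - be) be <= W2 be (1 - be)%R)%E.
    by apply/beP; rewrite ?subr_ge0 ?(ltW be1) // subrKC ?divr1.
  rewrite !le_min => /andP[+ _] /andP[+ _].
  rewrite !stop_costE ?subr_ge0 ?(ltW al1) ?(ltW be1) // !lee_fin; nra.
exists al, (1 - be); do 3 (split=> //); first by rewrite gerBl.
move=> a b a0 b0 ab0.
have ab0' : 0 < b + a by rewrite addrC.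
have abN : a + b != 0 by rewrite gt_eqF.
have baN : b + a != 0 by rewrite gt_eqF.
have beE : (1 - be <= a / (a + b)) = (b / (b + a) <= be).
  have -> : b / (b + a) = 1 - a / (a + b) by field; rewrite abN.
  by rewrite lerBlDl lerBlDr.
have {alP} := alP a b a0 b0 ab0; have {beP} := beP a b a0 b0 ab0'.
rewrite -beE /W1 /W2 /best_stop !le_min.
case: (leP (a / (a + b)) al) => [le1 _ [_ /(_ isT) /andP[-> ->]]|lt1].
  by rewrite lexx.
case: (leP (1 - be)) => [ge2 [_ /(_ isT) /andP[-> ->]] _|lt2].
  by rewrite lexx.
move=> [stop0 _] [stop1 _].
have {stop0} : ~~ ((stop_cost J false a b <= stop_cost J true a b) &&
  (stop_cost J false a b <= W a b))%E by apply/negP => /stop0.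
have {stop1} : ~~ ((stop_cost J true a b <= stop_cost J false a b) &&
  (stop_cost J true a b <= W a b))%E.
  by apply/negP => /stop1.
rewrite !negb_and -!ltNge lexx andbT.
case: (ltP (stop_cost J false a b) (stop_cost J true a b)) => [lt12 _ /=|le21 /=].
  rewrite ltNge (ltW lt12) /= => Wlt.
  by rewrite (ltW Wlt) (ltW (lt_trans Wlt lt12)).
by move=> Wlt _; rewrite (ltW Wlt) (le_trans (ltW Wlt) le21).
Qed.

End thresholds.

(** * The Bellman operator and the value function *)

Lemma emeasurable_sum_cond d (T : measurableType d) (R : realType) (D : set T)
    (I : Type) (r : seq I) (Q : pred I) (g : I -> T -> \bar R) :
  (forall i, measurable_fun D (g i)) ->
  measurable_fun D (fun x => \sum_(i <- r | Q i) g i x)%E.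
Proof.
by move=> mg; under eq_fun do rewrite -big_filter; exact: emeasurable_sum.
Qed.

Section bellman.
Context {R : realType} {X : finType} {d : measure_display} {S : measurableType d}.
Variables (mu : nat -> {sigma_finite_measure set S -> \bar R})
  (f : nat -> bool -> S -> R) (rho : nat -> bool -> seq X -> R)
  (c : R) (J : bool -> bool -> R).
Hypothesis f_ge0 : forall t h y, 0 <= f t.+1 h y.
Hypothesis measurable_f : forall t h, measurable_fun setT (f t.+1 h).
Hypothesis int_f : forall t h, (\int[mu t.+1]_y (f t.+1 h y)%:E = 1)%E.
Hypothesis rho_ge0 : forall t h z, 0 <= rho t h z.
Hypothesis sum_rho : forall t h z, (size z <= t)%N ->
  \sum_(z' : t.+1.-bseq X | take t z' == z) rho t h z' = 1.
Hypothesis c_ge0 : 0 <= c.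
Hypothesis J_ge0 : forall u h, 0 <= J u h.

Implicit Types (v : nat -> seq X -> R -> R -> \bar R).

(** The arguments of v are the masses after one more step: rho t h z' is the
probability, given H = h and the first t messages, that the history becomes z', and
f t.+1 h is the density of the new observation. *)
Definition branch v t (z' : seq X) (a b : R) (s : S) : \bar R :=
  v t.+1 z' (a * (rho t false z' * f t.+1 false s))
            (b * (rho t true z' * f t.+1 true s)).

(** The histories z' with take t z' = z are those that can follow z.  A history
that already contains a final message is its own successor, which is why
histories are sequences of length at most t rather than tuples. *)
Definition cont_cost v t (z : seq X) (a b : R) : \bar R :=
  (c%:E * (`|a| + `|b|)%:E +
   \sum_(z' : t.+1.-bseq X | take t z' == z)
      \int[mu t.+1]_s branch v t z' a b s)%E.

Definition bellman v t z a b : \bar R :=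
  mine (best_stop J a b) (cont_cost v t z a b).

Definition horizon_value n := iter n bellman (fun _ _ => best_stop J).

(** [einfs _ 0] is the infimum of the whole sequence. *)
Definition value t z a b : \bar R := einfs (fun n => horizon_value n t z a b) 0.

Definition regular_cost v := forall t z,
  measurable_fun setT (fun p : R * R => v t z p.1 p.2) /\ superlinear_cost (v t z).

Lemma measurable_transition t h z : measurable_fun setT
  (fun s => rho t h z * f t.+1 h s).
Proof. exact: measurable_funM. Qed.

Lemma measurable_branch2 v t z' : regular_cost v ->
  measurable_fun setT (fun q : (R * R) * S => branch v t z' q.1.1 q.1.2 q.2).
Proof.
move=> rv; have mw h : measurable_fun setT
    (fun q : (R * R) * S => rho t h z' * f t.+1 h q.2).
  exact: (measurableT_comp (measurable_transition t h z')).
have mq : measurable_fun setT (fun q : (R * R) * S =>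
    (q.1.1 * (rho t false z' * f t.+1 false q.2),
     q.1.2 * (rho t true z' * f t.+1 true q.2))).
  apply/measurable_fun_pair; apply: measurable_funM => //.
    exact: (measurableT_comp measurable_fst measurable_fst).
  exact: (measurableT_comp measurable_snd measurable_fst).
exact: (measurableT_comp (rv t.+1 z').1 mq).
Qed.

Lemma measurable_branch v t z' a b : regular_cost v ->
  measurable_fun setT (branch v t z' a b).
Proof.
move=> rv; exact: (measurableT_comp (measurable_branch2 t z' rv)
  (pair1_measurable (a, b))).
Qed.

Lemma branch_ge0 v t z' a b s : regular_cost v -> (0 <= branch v t z' a b s)%E.
Proof. by move=> rv; have [_ [v0 _ _]] := rv t.+1 z'; exact: v0. Qed.

Lemma transition_ge0 t h z' s : 0 <= rho t h z' * f t.+1 h s.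
Proof. exact: mulr_ge0. Qed.

Lemma regular_cont_cost v : regular_cost v -> regular_cost (cont_cost v).
Proof.
move=> rv t z; split.
  apply: emeasurable_funD.
    apply: measurable_funeM; apply/measurable_EFinP.
    by apply: measurable_funD; apply: measurableT_comp.
  apply: emeasurable_sum_cond => z'.
  have := @measurable_fun_fubini_tonelli_F _ _ _ _ _ (mu t.+1) _
    (measurable_branch2 t z' rv).
  by apply => q; exact: branch_ge0.
split=> [a b|k a b k0 a0 b0|a a' b b' a0 a'0 b0 b'0].
- rewrite adde_ge0 //; first by rewrite mule_ge0 // lee_fin addr_ge0.
  apply: sume_ge0 => z' _; apply: integral_ge0 => s _; exact: branch_ge0.
- rewrite /cont_cost ge0_muleDr; last 2 first.
  + by rewrite mule_ge0 // lee_fin addr_ge0.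
  + apply: sume_ge0 => z' _; apply: integral_ge0 => s _; exact: branch_ge0.
  congr (_ + _)%E.
    by rewrite -!EFinM; congr EFin; rewrite !normrM (ger0_norm k0); ring.
  rewrite ge0_sume_distrr; last first.
    by move=> z' _; apply: integral_ge0 => s _; exact: branch_ge0.
  apply: eq_bigr => z' _.
  rewrite -ge0_integralZl_EFin //; last 2 first.
  + by move=> s _; exact: branch_ge0.
  + exact: measurable_branch.
  apply: eq_integral => s _; rewrite /branch -!mulrA.
  by have [_ [_ -> //]] := rv t.+1 z'; rewrite mulr_ge0 ?transition_ge0.
- rewrite /cont_cost addeACA; apply: leeD.
    by rewrite -!EFinM -EFinD lee_fin !ger0_norm ?addr_ge0 //; lra.
  rewrite -big_split /=; apply: lee_sum => z' _.
  rewrite -ge0_integralD //; last 4 first.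
  + by move=> s _; exact: branch_ge0.
  + exact: measurable_branch.
  + by move=> s _; exact: branch_ge0.
  + exact: measurable_branch.
  apply: ge0_le_integral => //.
  + by move=> s _; rewrite adde_ge0 // branch_ge0.
  + by apply: emeasurable_funD; exact: measurable_branch.
  + exact: measurable_branch.
  + move=> s _; rewrite /branch !mulrDl.
    by have [_ [_ _ ]] := rv t.+1 z'; apply; rewrite mulr_ge0 ?transition_ge0.
Qed.

Lemma regular_best_stop : regular_cost (fun _ _ => best_stop J).
Proof.
move=> t z; split; last by apply: superlinear_mine; exact: superlinear_stop.
by apply: measurable_mine; apply/measurable_EFinP; apply: measurable_funD;
  apply: measurable_funM => //; apply: measurableT_comp.
Qed.

Lemma regular_bellman v : regular_cost v -> regular_cost (bellman v).
Proof.
move=> /regular_cont_cost rv t z; have [mv sv] := rv t z.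
have [ms ss] := regular_best_stop t z; split; last exact: superlinear_mine.
exact: measurable_mine.
Qed.

Lemma regular_horizon_value n : regular_cost (horizon_value n).
Proof. by elim: n => [|n IH]; [exact: regular_best_stop|exact: regular_bellman]. Qed.

Lemma value_le n t z a b : (value t z a b <= horizon_value n t z a b)%E.
Proof. by apply: ereal_inf_lbound; exists n. Qed.

Lemma le_value t z a b x : (forall n, x <= horizon_value n t z a b)%E ->
  (x <= value t z a b)%E.
Proof. by move=> h; apply: le_ereal_inf_tmp => _ [n _ <-]; exact: h. Qed.

Lemma regular_value : regular_cost value.
Proof.
move=> t z; split.
  apply: (measurable_fun_einfs (f := fun n p => horizon_value n t z p.1 p.2)) => n.
  by have [] := regular_horizon_value n t z.
split=> [a b|k a b k0 a0 b0|a a' b b' a0 a'0 b0 b'0].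
- by apply: le_value => n; have [_ []] := regular_horizon_value n t z.
- have hom n := let: conj _ (And3 _ h _) := regular_horizon_value n t z in h.
  have [->|kN0] := eqVneq k 0.
    rewrite mul0e; apply/eqP; rewrite eq_le; apply/andP; split.
      by apply: le_trans (value_le 0 _ _ _ _) _; rewrite hom // mul0e.
    by apply: le_value => n; rewrite hom // mul0e.
  have k_gt0 : 0 < k by rewrite lt_def kN0.
  apply/eqP; rewrite eq_le; apply/andP; split.
    rewrite -lee_pdivrMl //; apply: le_value => n.
    by rewrite lee_pdivrMl // -hom // value_le.
  apply: le_value => n; rewrite hom //; apply: lee_wpmul2l => //.
  exact: value_le.
- apply: le_value => n.
  have [_ [_ _ add]] := regular_horizon_value n t z.
  by apply: le_trans (add _ _ _ _ _ _ _ _) => //; apply: leeD; exact: value_le.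
Qed.

Lemma cont_cost_le v v' t z a b : regular_cost v -> regular_cost v' ->
  0 <= a -> 0 <= b ->
  (forall z' a b, 0 <= a -> 0 <= b -> (v t.+1 z' a b <= v' t.+1 z' a b)%E) ->
  (cont_cost v t z a b <= cont_cost v' t z a b)%E.
Proof.
move=> rv rv' a0 b0 vv'; apply: leeD => //; apply: lee_sum => z' _.
apply: ge0_le_integral => //.
- by move=> s _; exact: branch_ge0.
- exact: measurable_branch.
- exact: measurable_branch.
- by move=> s _; apply: vv'; rewrite mulr_ge0 ?transition_ge0.
Qed.

(** By monotonicity each horizon_value n.+1 is at least the Bellman operator applied to
[value]. *)
Lemma bellman_value_le t z a b : 0 <= a -> 0 <= b ->
  (bellman value t z a b <= value t z a b)%E.
Proof.
move=> a0 b0; apply: le_value => -[|n]; first by rewrite ge_min /= lexx.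
rewrite /= /bellman le_min [X in X && _]ge_min [X in _ && X]ge_min lexx /=.
apply/orP; right.
apply: cont_cost_le => //; [exact: regular_value|exact: regular_horizon_value|].
by move=> *; exact: value_le.
Qed.

Lemma integral_transition t h z' x : 0 <= x ->
  (\int[mu t.+1]_s (x * (rho t h z' * f t.+1 h s))%:E = (x * rho t h z')%:E)%E.
Proof.
move=> x0; under eq_integral do rewrite mulrA EFinM.
rewrite ge0_integralZl_EFin ?int_f ?mule1 //.
- by move=> s _; rewrite lee_fin.
- by apply/measurable_EFinP.
- exact: mulr_ge0.
Qed.

(** The messages that follow z have total probability one and f is a probability
density, so a lower bound that is linear in one of the masses survives a step. *)
Lemma le_cont_cost_axis v t z h a b p : regular_cost v -> (size z <= t)%N ->
  0 <= a -> 0 <= b -> 0 <= p ->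
  (forall z' a b, (size z' <= t.+1)%N -> 0 <= a -> 0 <= b ->
     ((p * (if h then b else a))%:E <= v t.+1 z' a b)%E) ->
  ((p * (if h then b else a))%:E <= cont_cost v t z a b)%E.
Proof.
move=> rv szt a0 b0 p0 vp.
have x0 : 0 <= (if h then b else a) by case: (h).
apply: (@le_trans _ _ (\sum_(z' : t.+1.-bseq X | take t z' == z)
   \int[mu t.+1]_s (p * (if h then b else a) * (rho t h z' * f t.+1 h s))%:E)%E).
  rewrite (eq_bigr (fun z' : t.+1.-bseq X =>
     (p * (if h then b else a) * rho t h z')%:E)); last first.
    by move=> z' _; rewrite integral_transition // mulr_ge0.
  by rewrite sumEFin -mulr_sumr sum_rho ?mulr1.
rewrite -[leLHS]add0e; apply: leeD; first by rewrite mule_ge0 // lee_fin addr_ge0.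
apply: lee_sum => z' _; apply: ge0_le_integral => //.
- by move=> s _; rewrite lee_fin mulr_ge0 ?transition_ge0 // mulr_ge0.
- apply/measurable_EFinP; apply: measurable_funM => //.
  exact: measurable_transition.
- exact: measurable_branch.
- move=> s _; have sz' : (size z' <= t.+1)%N by exact: size_bseq.
  have := vp z' _ _ sz' (mulr_ge0 a0 (transition_ge0 t false z' s))
                        (mulr_ge0 b0 (transition_ge0 t true z' s)).
  by apply: le_trans; rewrite lee_fin; case: (h); rewrite -mulrA.
Qed.

(** The best cost under hypothesis h bounds every cost from below.  At the end points
of the belief interval this says that stopping with the right action is best. *)
Lemma le_value_axis h p t z a b : 0 <= p -> (forall u, p <= J u h) ->
  (size z <= t)%N -> 0 <= a -> 0 <= b ->
  ((p * (if h then b else a))%:E <= value t z a b)%E.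
Proof.
move=> p0 pJ szt a0 b0; apply: le_value => n.
have stop_h u a' b' : 0 <= a' -> 0 <= b' ->
    ((p * (if h then b' else a'))%:E <= stop_cost J u a' b')%E.
  move=> a'0 b'0; rewrite stop_costE // lee_fin mulrC; have := pJ u.
  have := J_ge0 u false; have := J_ge0 u true; case: (h) => *.
    by rewrite (le_trans (ler_wpM2l _ (_ : p <= J u true))) // lerDr mulr_ge0.
  by rewrite (le_trans (ler_wpM2l _ (_ : p <= J u false))) // lerDl mulr_ge0.
elim: n t z a b szt a0 b0 => [|n IH] t z a b szt a0 b0.
  by rewrite le_min !stop_h.
rewrite /= /bellman !le_min !stop_h //=.
apply: le_cont_cost_axis => //; first exact: regular_horizon_value.
by move=> z' a' b' *; exact: IH.
Qed.

Lemma value_thresholds t z :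
  J true true < J false true -> J false false < J true false ->
  exists alpha beta : R, 0 <= alpha /\ alpha <= beta /\ beta <= 1 /\
    ((size z <= t)%N -> forall a b, 0 <= a -> 0 <= b -> 0 < a + b ->
    ((if (a / (a + b) <= alpha)%R then stop_cost J true a b
      else if (a / (a + b) < beta)%R then cont_cost value t z a b
      else stop_cost J false a b) <= value t z a b)%E).
Proof.
move=> J1 J0; have [szt|szt] := leqP (size z) t; last first.
  by exists 0, 0; rewrite lexx ler01.
have [|||al [be [al0 [albe [be1 abP]]]]] :=
  @optimal_thresholds _ J (cont_cost value t z) J_ge0 J1 J0.
- by have [] := regular_cont_cost regular_value t z.
- rewrite stop_costE // mul0r add0r mul1r -[J _ _]mulr1.
  apply: (@le_cont_cost_axis _ _ _ true 0 1) => //; first exact: regular_value.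
  move=> z' a b *; apply: (le_value_axis (h := true)) => // -[] //; exact: ltW.
- rewrite stop_costE // mul0r addr0 mul1r -[J _ _]mulr1.
  apply: (@le_cont_cost_axis _ _ _ false 1 0) => //; first exact: regular_value.
  move=> z' a b *; apply: (le_value_axis (h := false)) => // -[] //; exact: ltW.
exists al, be; do 3 (split => //); move=> _ a b a0 b0 ab0.
by apply: le_trans (bellman_value_le _ _ _ _) => //; exact: abP.
Qed.

End bellman.

(** * Densities and laws of random elements *)

Lemma measurable_invr (R : realType) : measurable_fun setT (@GRing.inv R).
Proof.
have -> : [set: R] = [set 0] `|` ~` [set 0] by rewrite setUCr.
apply/measurable_funU; [by []|exact: measurableC|split].
  exact: measurable_fun_set1.
apply: open_continuous_measurable_fun.
  by apply: closed_openC; exact: closed_eq.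
by move=> x; rewrite inE => /eqP; exact: inv_continuous.
Qed.

Section density.
Context {d} {T : measurableType d} {R : realType}.

(** g is the Radon-Nikodym derivative of nu up to a null set, for which the change of
variables is known. *)
Lemma integral_density (nu : {finite_measure set T -> \bar R})
    (mu : {sigma_finite_measure set T -> \bar R}) (g : T -> \bar R) :
  (forall x, 0 <= g x)%E -> measurable_fun setT g ->
  (forall A, measurable A -> nu A = \int[mu]_(x in A) g x)%E ->
  forall (G : T -> \bar R) A, (forall x, 0 <= G x)%E -> measurable_fun setT G ->
  measurable A -> (\int[nu]_(x in A) G x = \int[mu]_(x in A) (G x * g x))%E.
Proof.
move=> g0 mg nug G A G0 mG mA.
have numu : nu `<< mu.
  apply/null_content_dominatesP => B mB muB0; rewrite nug //.
  by apply: null_set_integral => //; exact: measurable_funTS.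
have intg : mu.-integrable setT g.
  apply/integrableP; split => //.
  under eq_integral do rewrite gee0_abs //.
  by rewrite -nug // -ge0_fin_numE // fin_num_measure.
have RNg := Radon_Nikodym_SigmaFinite.f_integral numu.
have mRN : measurable_fun setT (Radon_Nikodym_SigmaFinite.f nu mu).
  exact: measurable_int (Radon_Nikodym_SigmaFinite.f_integrable numu).
have ae : ae_eq mu setT g (Radon_Nikodym_SigmaFinite.f nu mu).
  by apply: integral_ae_eq => // E _ mE; rewrite -nug // RNg.
rewrite -(Radon_Nikodym_SigmaFinite.change_of_variables numu) //; last first.
  exact: measurable_funTS.
apply: ge0_ae_eq_integral => //.
- by apply: measurable_funTS; exact: emeasurable_funM.
- by apply: measurable_funTS; exact: emeasurable_funM.
- by move=> x _; rewrite mule_ge0 // Radon_Nikodym_SigmaFinite.f_ge0.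
- by move=> x _; rewrite mule_ge0.
- by apply: filterS ae => x gx _; rewrite gx.
Qed.

Lemma density_measure (mu : {measure set T -> \bar R}) (g : T -> \bar R) :
  (forall x, 0 <= g x)%E -> measurable_fun setT g ->
  exists nu : {measure set T -> \bar R},
    forall A, nu A = (\int[mu]_(x in A) g x)%E.
Proof.
move=> g0 mg; pose m A := (\int[mu]_(x in A) g x)%E.
have m0 : m set0 = 0%E by rewrite /m integral_set0.
have m_ge0 A : (0 <= m A)%E by exact: integral_ge0.
have m_add : semi_sigma_additive m by exact: semi_sigma_additive_nng_induced.
pose M := isMeasure.Build _ _ _ m m0 m_ge0 m_add.
pose nu : {measure set T -> \bar R} := HB.pack m M.
by exists nu.
Qed.

Lemma finite_measureP (m : {measure set T -> \bar R}) : (m setT < +oo)%E ->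
  exists nu : {finite_measure set T -> \bar R}, nu = m :> (set T -> \bar R).
Proof.
move=> mfin; exists (mfrestr measurableT mfin).
by apply/funext => A; rewrite /= /mfrestr /mrestr setIT.
Qed.

End density.

(** The law of X restricted to the event D.  The integral formula covers every
measurable G: a version of the belief is not known to be integrable. *)
Lemma event_law d (T : measurableType d) (R : realType)
    (P : {finite_measure set T -> \bar R}) (D : set T)
    d' (U : measurableType d') (X : T -> U) :
  measurable D -> measurable_fun setT X ->
  exists nu : {finite_measure set U -> \bar R},
    (forall A, measurable A -> nu A = P (D `&` X @^-1` A)) /\
    (forall (G : U -> \bar R) A, measurable_fun setT G -> measurable A ->
      \int[nu]_(x in A) G x = \int[P]_(w in D `&` X @^-1` A) G (X w))%E.
Proof.
move=> mD mX.
have mXA A : measurable A -> measurable (X @^-1` A).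
  by move=> mA; rewrite -[_ @^-1` _]setTI; exact: mX.
have PDfin : (P D < +oo)%E by rewrite -ge0_fin_numE // fin_num_measure.
pose r : {finite_measure set T -> \bar R} := mfrestr mD PDfin.
have rE A : measurable A -> r A = (\int[P]_(x in A) (\1_D x)%:E)%E.
  by move=> mA; rewrite integral_indic // setIC.
have [pf pfE] : exists m : {measure set U -> \bar R},
    m = pushforward r X :> (set U -> \bar R).
  by unshelve eexists (pushforward r X).
have [nu nuE] : exists nu : {finite_measure set U -> \bar R},
    nu = pf :> (set U -> \bar R).
  apply: finite_measureP; rewrite pfE /pushforward -ge0_fin_numE //.
  by rewrite fin_num_measure //; exact: mXA.
have ge0_case (G : U -> \bar R) A : (forall x, 0 <= G x)%E ->
    measurable_fun setT G -> measurable A ->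
    (\int[nu]_(x in A) G x = \int[P]_(w in D `&` X @^-1` A) G (X w))%E.
  move=> G0 mG mA; rewrite nuE pfE ge0_integral_pushforward //; last first.
    exact: measurable_funTS.
  have mGX : measurable_fun setT (G \o X) by exact: measurableT_comp.
  have m1 : measurable_fun setT (EFin \o \1_D : T -> \bar R).
    by apply/measurable_EFinP.
  have pos1 x : (0 <= (EFin \o \1_D : T -> \bar R) x)%E by rewrite lee_fin.
  rewrite (integral_density pos1 m1 rE) //; [|by move=> x; exact: G0|exact: mXA].
  by rewrite setIC integral_mkcondr epatch_indic.
exists nu; split=> [A mA|G A mG mA].
  by rewrite nuE pfE /pushforward /r /= /mfrestr /mrestr setIC.
rewrite integralE [RHS]integralE !ge0_case //.
- by congr (_ - _)%E; apply: eq_integral => w _; rewrite ?funeposE ?funenegE.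
- exact: measurable_funeneg.
- exact: measurable_funepos.
Qed.

(** * Product reference measure and likelihoods on tuples *)

Section tuples.
Context {d} {S : measurableType d}.

Definition tuple_init t (y : t.+1.-tuple S) : t.-tuple S :=
  [tuple tnth y (widen_ord (leqnSn t) i) | i < t].

Definition tuple_rcons t (q : t.-tuple S * S) : t.+1.-tuple S :=
  [tuple of rcons q.1 q.2].

Lemma tnth_tuple_rcons_widen t (q : t.-tuple S * S) i :
  tnth (tuple_rcons q) (widen_ord (leqnSn t) i) = tnth q.1 i.
Proof.
by rewrite !(tnth_nth q.2) /= nth_rcons size_tuple ltn_ord.
Qed.

Lemma tnth_tuple_rcons_max t (q : t.-tuple S * S) :
  tnth (tuple_rcons q) ord_max = q.2.
Proof. by rewrite (tnth_nth q.2) /= nth_rcons size_tuple ltnn eqxx. Qed.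

Lemma tuple_rconsK t (q : t.-tuple S * S) : tuple_init (tuple_rcons q) = q.1.
Proof.
by apply: eq_from_tnth => i; rewrite tnth_mktuple tnth_tuple_rcons_widen.
Qed.

Lemma ord_split t (i : 'I_t.+1) :
  i = ord_max \/ exists j, i = widen_ord (leqnSn t) j.
Proof.
have [ilt|ige] := ltnP i t; [right|left].
  by exists (Ordinal ilt); apply: val_inj.
by apply: val_inj => /=; apply/eqP; rewrite eqn_leq ige -ltnS ltn_ord.
Qed.

Lemma measurable_tuple_init t : measurable_fun setT (@tuple_init t).
Proof.
apply/measurable_fun_tnthP => i.
rewrite (_ : _ \o _ = (fun y => tnth y (widen_ord (leqnSn t) i))).
  exact: measurable_tnth.
by apply/funext => y /=; rewrite tnth_mktuple.
Qed.

Lemma measurable_tuple_rcons t : measurable_fun setT (@tuple_rcons t).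
Proof.
apply/measurable_fun_tnthP => i; have [->|[j ->]] := ord_split i.
  rewrite (_ : _ \o _ = snd); first exact: measurable_snd.
  by apply/funext => y /=; rewrite tnth_tuple_rcons_max.
rewrite (_ : _ \o _ = (fun q : t.-tuple S * S => tnth q.1 j)).
  exact: (measurableT_comp (measurable_tnth j) measurable_fst).
by apply/funext => y /=; rewrite tnth_tuple_rcons_widen.
Qed.

Definition box (A : nat -> set S) t : set (t.-tuple S) :=
  [set y | forall i : 'I_t, A i.+1 (tnth y i)].

Arguments box A t _ : clear implicits.

Lemma measurable_box A t : (forall s, measurable (A s)) -> measurable (box A t).
Proof.
move=> mA; rewrite (_ : box A t = \bigcap_(i in [set: 'I_t])
    ((fun y => tnth y i) @^-1` (A i.+1))); last first.
  by apply/seteqP; split => y /= yA i; [move=> _|]; exact: yA.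
apply: fin_bigcap_measurable => // i _.
by rewrite -[_ @^-1` _]setTI; exact: measurable_tnth.
Qed.

(** Boxes are stable under intersection and generate the sigma-algebra of tuples. *)
Lemma eq_measure_box (R : realType) t (m1 m2 : {measure set (t.-tuple S) -> \bar R}) :
  (m1 setT < +oo)%E ->
  (forall A, (forall s, measurable (A s)) -> m1 (box A t) = m2 (box A t)) ->
  forall B, measurable B -> m1 B = m2 B.
Proof.
move=> m1fin m12 B mB.
pose G := [set box A t | A in [set A | forall s, measurable (A s)]].
have GT : G setT.
  by exists (fun=> setT) => //; apply/seteqP; split.
apply: (@measure_unique _ _ _ G (fun=> setT)) => //.
- apply/seteqP; split.
    apply: smallest_sub; first exact: smallest_sigma_algebra.
    rewrite -bigcup_seq; apply: bigcup_sub => i _ _ [C mC <-].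
    apply: sub_sigma_algebra; exists (fun s => if s == i.+1 then C else setT).
      by move=> s; case: ifP.
    apply/seteqP; split => y /= yC.
      by split => //; have := yC i; rewrite eqxx.
    by move=> j; case: ifPn => [/eqP[ji]|//]; case: yC; have -> : j = i by apply: val_inj.
  apply: smallest_sub; first exact: sigma_algebra_measurable.
  by move=> _ [A mA <-]; exact: measurable_box.
- move=> _ _ [A mA <-] [A' mA' <-]; exists (fun s => A s `&` A' s).
    by move=> s; exact: measurableI.
  by apply/seteqP; split => y /= h; [split=> i; case: (h i)|move=> i; split; case: h].
- by apply/seteqP; split => // y _; exists 0%N.
- by move=> _ [A mA <-]; exact: m12.
Qed.

End tuples.
Arguments box {d S} A t _.

Section tuple_measure.
Context {d} {S : measurableType d} {R : realType}.

Section step.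
Context {t : nat} (m : {sigma_finite_measure set (t.-tuple S) -> \bar R})
  (mu : {sigma_finite_measure set S -> \bar R}).

Definition snoc_measure : set (t.+1.-tuple S) -> \bar R :=
  pushforward (m \x mu)%E (@tuple_rcons _ S t).

Let snoc_measure_measure : exists m' : {measure set (t.+1.-tuple S) -> \bar R},
  m' = snoc_measure :> (set _ -> \bar R).
Proof.
unshelve eexists (pushforward (m \x mu)%E (@tuple_rcons _ S t)) => //.
exact: measurable_tuple_rcons.
Qed.

Let snoc_measure0 : snoc_measure set0 = 0%E.
Proof. by have [m' <-] := snoc_measure_measure; exact: measure0. Qed.

Let snoc_measure_ge0 A : (0 <= snoc_measure A)%E.
Proof. by have [m' <-] := snoc_measure_measure; exact: measure_ge0. Qed.

Let snoc_measure_additive : semi_sigma_additive snoc_measure.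
Proof.
by have [m' <-] := snoc_measure_measure; exact: measure_semi_sigma_additive.
Qed.

HB.instance Definition _ := isMeasure.Build _ _ _ snoc_measure
  snoc_measure0 snoc_measure_ge0 snoc_measure_additive.

Let snoc_measure_sigma_finite : sigma_finite setT snoc_measure.
Proof.
have /sigma_finiteP[F [FT ndF Foo]] := sigma_finiteT m.
have /sigma_finiteP[G [GT ndG Goo]] := sigma_finiteT mu.
pose E n : set (t.+1.-tuple S) := (@tuple_init _ S t @^-1` F n) `&`
  ((fun y : t.+1.-tuple S => tnth y ord_max) @^-1` G n).
exists E.
  rewrite predeqE => y; split=> // _.
  have : [set: _] (tuple_init y) by []; rewrite FT => -[n _ Fn].
  have : [set: _] (tnth y ord_max) by []; rewrite GT => -[k _ Gk].
  exists (maxn n k) => //; split => /=.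
  - by move: (tuple_init y) Fn; exact/subsetPset/ndF/leq_maxl.
  - by move: (tnth y _) Gk; exact/subsetPset/ndG/leq_maxr.
move=> n; have [mF Ffin] := Foo n; have [mG Gfin] := Goo n; split.
  apply: measurableI; rewrite -[_ @^-1` _]setTI.
    exact: measurable_tuple_init.
  exact: measurable_tnth.
rewrite /snoc_measure /pushforward (_ : _ @^-1` _ = F n `*` G n); last first.
  by apply/seteqP; split => q; rewrite /E /= tuple_rconsK tnth_tuple_rcons_max.
by rewrite product_measure1E // lte_mul_pinfty // ge0_fin_numE.
Qed.

HB.instance Definition _ := Measure_isSigmaFinite.Build _ _ _ snoc_measure
  snoc_measure_sigma_finite.

End step.

Variable mu : nat -> {sigma_finite_measure set S -> \bar R}.

Fixpoint tuple_measure t : {sigma_finite_measure set (t.-tuple S) -> \bar R} :=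
  if t is t'.+1 then snoc_measure (tuple_measure t') (mu t'.+1)
  else \d_ [tuple].

Lemma integral_tuple_measureS t (B : set (t.-tuple S)) (G : t.+1.-tuple S -> \bar R) :
  measurable B -> measurable_fun setT G -> (forall y, 0 <= G y)%E ->
  (\int[tuple_measure t.+1]_(y in (@tuple_init _ S t) @^-1` B) G y =
   \int[tuple_measure t]_(y in B) \int[mu t.+1]_s G (tuple_rcons (y, s)))%E.
Proof.
move=> mB mG G0.
have mIB : measurable ((@tuple_init _ S t) @^-1` B).
  by rewrite -[_ @^-1` _]setTI; exact: measurable_tuple_init.
have mGr : measurable_fun setT (G \o @tuple_rcons _ S t).
  by apply: measurableT_comp => //; exact: measurable_tuple_rcons.
have mGB : measurable_fun setT (G \_ (@tuple_init _ S t @^-1` B)).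
  apply/measurable_restrict => //; exact: measurable_funTS.
have GB0 y : (0 <= (G \_ (@tuple_init _ S t @^-1` B)) y)%E.
  by rewrite patchE; case: ifP.
rewrite integral_mkcond /= ge0_integral_pushforward //; last first.
  exact: measurable_tuple_rcons.
rewrite preimage_setT fubini_tonelli1; last first.
  by move=> q; exact: GB0.
  by apply: measurableT_comp => //; exact: measurable_tuple_rcons.
rewrite [RHS]integral_mkcond; apply: eq_integral => y _.
rewrite /fubini_F patchE /=.
have inB s : (tuple_rcons (y, s) \in @tuple_init _ S t @^-1` B) = (y \in B).
  by apply/idP/idP; rewrite !inE /= tuple_rconsK.
case: ifPn => yB.
  by apply: eq_integral => s _; rewrite patchE inB yB.
by apply: integral0_eq => s _; rewrite patchE inB (negbTE yB).
Qed.

End tuple_measure.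

Section likelihood.
Context {d} {S : measurableType d} {R : realType}.
Variables (mu : nat -> {sigma_finite_measure set S -> \bar R}) (f : nat -> S -> R).
Hypothesis f_ge0 : forall t y, 0 <= f t.+1 y.
Hypothesis measurable_f : forall t, measurable_fun setT (f t.+1).

Definition likelihood t (y : t.-tuple S) : R := \prod_(i < t) f i.+1 (tnth y i).

Lemma likelihood_rcons t (q : t.-tuple S * S) :
  likelihood (tuple_rcons q) = likelihood q.1 * f t.+1 q.2.
Proof.
rewrite /likelihood big_ord_recr /= tnth_tuple_rcons_max.
by congr (_ * _); apply: eq_bigr => i _; rewrite tnth_tuple_rcons_widen.
Qed.

Lemma likelihood_ge0 t (y : t.-tuple S) : 0 <= likelihood y.
Proof. exact: prodr_ge0. Qed.

Lemma measurable_likelihood t : measurable_fun setT (@likelihood t).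
Proof.
apply: measurable_prod => i _.
exact: (measurableT_comp (measurable_f i) (measurable_tnth i)).
Qed.

(** Tonelli's theorem, one coordinate at a time. *)
Lemma integral_likelihood_box A (q : nat -> R) t :
  (forall s, measurable (A s)) ->
  (forall s, \int[mu s.+1]_(y in A s.+1) (f s.+1 y)%:E = (q s.+1)%:E)%E ->
  (\int[tuple_measure mu t]_(y in box A t) (likelihood y)%:E =
   (\prod_(1 <= s < t.+1) q s)%:E)%E.
Proof.
move=> mA qE; elim: t => [|t IH].
  rewrite big_geq // (_ : box A 0 = setT); last by apply/seteqP; split => // y _ [].
  under eq_integral do rewrite /likelihood big_ord0.
  by rewrite integral_cst //= diracT mul1e.
have -> : box A t.+1 = (@tuple_init _ S t @^-1` box A t) `&`
    ((fun y : t.+1.-tuple S => tnth y ord_max) @^-1` A t.+1).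
  apply/seteqP; split => y.
    move=> h; split; last exact: (h ord_max).
    by move=> i; rewrite tnth_mktuple; exact: (h (widen_ord _ i)).
  move=> [h1 h2] i; have [->//|[j ->]] := ord_split i.
  by have := h1 j; rewrite tnth_mktuple.
have mlast : measurable ((fun y : t.+1.-tuple S => tnth y ord_max) @^-1` A t.+1).
  by rewrite -[_ @^-1` _]setTI; exact: measurable_tnth.
rewrite integral_mkcondr epatch_indic integral_tuple_measureS; last 3 first.
- exact: measurable_box.
- apply: emeasurable_funM; apply/measurable_EFinP => //.
  exact: measurable_likelihood.
- by move=> y; rewrite -EFinM lee_fin mulr_ge0 // likelihood_ge0.
rewrite [in RHS]big_nat_recr //= [in RHS]EFinM -IH -qE -ge0_integralZr //; last 4 first.
- exact: measurable_box.
- by apply: measurable_funTS; apply/measurable_EFinP; exact: measurable_likelihood.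
- by move=> y _; rewrite lee_fin likelihood_ge0.
- by apply: integral_ge0 => y _; rewrite lee_fin.
apply: eq_integral => y _.
rewrite -ge0_integralZl_EFin ?likelihood_ge0 //; last 2 first.
- by move=> s _; rewrite lee_fin.
- by apply: measurable_funTS; apply/measurable_EFinP.
rewrite [RHS]integral_mkcond; apply: eq_integral => s _.
rewrite likelihood_rcons /= patchE indicE.
rewrite (_ : (tuple_rcons (y, s) \in _) = (s \in A t.+1)); last first.
  by apply/idP/idP; rewrite !inE /= tnth_tuple_rcons_max.
by case: ifP => h; rewrite ?mule1 ?mule0 // -EFinM.
Qed.

End likelihood.

(** * Stopping times and message histories *)

Section first_time.
Context {R : realType}.
Implicit Types U : nat -> option bool.

Definition running U t := all (fun s => U s == None) (iota 1 t).

Lemma runningS U t : running U t.+1 = running U t && (U t.+1 == None).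
Proof. by rewrite /running -{1}[t.+1]addn1 iotaD all_cat /= andbT add1n. Qed.

Lemma running_first_time U t :
  running U t = oapp (fun k => (t < k)%N) true (first_time U).
Proof.
rewrite /first_time; case: pselect => [h|h] /=.
  case: ex_minnP => k /andP[k0 Uk] kmin.
  apply/allP/idP => [none|tk s].
    rewrite ltnNge; apply/negP => kt; move: Uk.
    by rewrite (eqP (none k _)) // mem_iota k0 add1n ltnS.
  rewrite mem_iota add1n ltnS => /andP[s0 st].
  apply/negPn/negP => Us; have := kmin s.
  rewrite s0 /= leqNgt (leq_ltn_trans st tk); case: (U s) Us => //= b _.
  by move=> /(_ isT).
apply/allP => s; rewrite mem_iota => /andP[s0 _].
by apply/negPn/negP => Us; apply: h; exists s; rewrite s0; case: (U s) Us.
Qed.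

Lemma first_timeP U k : first_time U = Some k -> (0 < k)%N /\ isSome (U k).
Proof.
rewrite /first_time; case: pselect => // h [<-].
by case: ex_minnP => m /andP[].
Qed.

Lemma eseries_finite (u : nat -> \bar R) N : (forall i, (N <= i)%N -> u i = 0%E) ->
  (\sum_(0 <= i <oo) u i = \sum_(0 <= i < N) u i)%E.
Proof.
move=> u0; apply: lim_near_cst => //; exists N => // n /= Nn.
rewrite (big_cat_nat _ Nn) //= [X in (_ + X)%E]big_nat_cond.
by rewrite [X in (_ + X)%E]big1 ?adde0 // => i /andP[/andP[Ni _] _]; exact: u0.
Qed.

(** Expectations of stopping times become series of probabilities of still running. *)
Lemma time_val_series U :
  time_val R (first_time U) = (\sum_(0 <= t <oo) (running U t)%:R%:E)%E.
Proof.
under eq_eseriesr do rewrite running_first_time.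
case: (first_time U) => [k|] /=.
  rewrite (@eseries_finite _ k) => [|i ki]; last by rewrite ltnNge ki.
  rewrite big_nat_cond (eq_bigr (fun=> 1%:E)) => [|i /andP[/andP[_ ->]]//].
  by rewrite -big_nat_cond sumEFin sumr_const_nat subn0.
apply/esym/eqyP => r r0.
pose n := (Num.truncn r).+1.
apply: (@le_trans _ _ (\sum_(0 <= t < n) 1%:E)%E).
  rewrite sumEFin sumr_const_nat subn0 lee_fin ltW //.
  exact: truncnS_gt.
by apply: nneseries_lim_ge => i _; rewrite lee_fin.
Qed.

Lemma terminal_series U (g : bool -> R) :
  (if first_time U is Some t then oapp g 0 (U t) else 0)%:E =
  (\sum_(0 <= t <oo) ((running U t)%:R * oapp g 0 (U t.+1))%:E)%E.
Proof.
under eq_eseriesr do rewrite running_first_time.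
case E: (first_time U) => [k|] /=.
  have [k0 _] := first_timeP E.
  have [n kE] : exists n, k = n.+1 by exists k.-1; rewrite prednK.
  rewrite (@eseries_finite _ k) => [|i ki]; last by rewrite ltnNge ki mul0r.
  rewrite kE big_nat_recr //= ltnSn mul1r big_nat_cond big1 ?add0e // => i.
  move=> /andP[/andP[_ i_n] _]; rewrite ltnS ltnW // mul1r.
  have : running U i.+1 by rewrite running_first_time E kE /= ltnS.
  by rewrite runningS => /andP[_ /eqP ->].
rewrite eseries0 // => i _ _; have : running U i.+1 by rewrite running_first_time E.
by rewrite runningS => /andP[_ /eqP ->]; rewrite mulr0.
Qed.

End first_time.

Section message_history.
Context {T S1 : Type} (Y : nat -> T -> S1) (g1 : policy1 S1).

Lemma msgsS t w : msgs Y g1 t.+1 w =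
  if running (fun s => msg Y g1 s w) t then rcons (msgs Y g1 t w) (msg Y g1 t.+1 w)
  else msgs Y g1 t w.
Proof.
rewrite /msgs -{1}[t.+1]addn1 iotaD filter_cat map_cat /= running_first_time /tau1.
rewrite add1n (_ : oapp (leq t.+1) _ _ = oapp (fun k => t < k)%N true
  (first_time (fun s => msg Y g1 s w))) //.
by case: ifP => _; rewrite ?cats1 ?cats0.
Qed.

Lemma running_msgs t w :
  running (fun s => msg Y g1 s w) t = ~~ has isSome (msgs Y g1 t w).
Proof.
elim: t => [|t IH]; first by rewrite /msgs.
rewrite msgsS runningS; case: ifP => rt; last by rewrite /= -IH rt.
by rewrite /= has_rcons negb_or -IH rt andbT; case: (msg _ _ _ _).
Qed.

Lemma size_msgs t w : (size (msgs Y g1 t w) <= t)%N.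
Proof.
by rewrite /msgs size_map size_filter (leq_trans (count_size _ _)) // size_iota.
Qed.

Lemma take_msgs t w : take t (msgs Y g1 t.+1 w) = msgs Y g1 t w.
Proof.
rewrite msgsS; case: ifP => rt; last by rewrite take_oversize // size_msgs.
rewrite -cats1 take_size_cat //.
move: rt; rewrite running_first_time /msgs /tau1 size_map size_filter.
case: (first_time _) => [k|] /= => [tk|_]; last by rewrite count_predT size_iota.
rewrite -[RHS](size_iota 1 t); apply/eqP; rewrite -all_count.
apply/allP => s; rewrite mem_iota add1n ltnS => /andP[_ st].
exact: leq_trans st (ltnW tk).
Qed.

End message_history.

Section history_events.
Context {T : Type} {d} {S : measurableType d} (Y : nat -> T -> S).

Lemma tuple_init_hist t w : tuple_init (hist Y t.+1 w) = hist Y t w.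
Proof. by apply: eq_from_tnth => i; rewrite !tnth_mktuple. Qed.

(** tau^1 depends on all the observations of O1, but whether it has occurred by time t
can be read off the messages sent so far. *)
Lemma msgs_hist_event (g1 : policy1 S) t z : measurable_policy1 g1 ->
  exists2 A : set (t.-tuple S), measurable A &
    forall w, msgs Y g1 t w = z <-> A (hist Y t w).
Proof.
move=> mg1; elim: t z => [|t IH] z.
  exists [set y | [::] = z]; last by [].
  have [zE|zN] := pselect ([::] = z).
    by rewrite (_ : [set _ | _] = setT) //; apply/seteqP; split.
  by rewrite (_ : [set _ | _] = set0) //; apply/seteqP; split.
have mI A : measurable A -> measurable (@tuple_init _ S t @^-1` A).
  by move=> mA; rewrite -[_ @^-1` _]setTI; exact: measurable_tuple_init.
have [A1 mA1 A1E] : exists2 A : set (t.+1.-tuple S), measurable A & forall w,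
    (has isSome (msgs Y g1 t w) /\ msgs Y g1 t w = z) <-> A (hist Y t.+1 w).
  have [A mA AE] := IH z; have [hz|hz] := boolP (has isSome z).
    exists (@tuple_init _ S t @^-1` A); first exact: mI.
    move=> w /=; rewrite tuple_init_hist -AE.
    by split => [[]//|zE]; rewrite zE.
  exists set0 => // w; split => // -[h zE].
  by move: h; rewrite zE (negbTE hz).
have [A2 mA2 A2E] : exists2 A : set (t.+1.-tuple S), measurable A & forall w,
    (~~ has isSome (msgs Y g1 t w) /\
     rcons (msgs Y g1 t w) (msg Y g1 t.+1 w) = z) <-> A (hist Y t.+1 w).
  clear A1 mA1 A1E; case/lastP: z => [|z m].
    by exists set0 => // w; split => // -[_ /eqP]; rewrite -size_eq0 size_rcons.
  have [A mA AE] := IH z; have [hz|hz] := boolP (has isSome z).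
    exists set0 => // w; split => // -[h /rcons_inj[zE _]].
    by move: h; rewrite zE hz.
  exists (@tuple_init _ S t @^-1` A `&` [set y | g1 t.+1 y = m]).
    by apply: measurableI; [exact: mI|exact: mg1].
  move=> w /=; rewrite tuple_init_hist -AE; split=> [[_ /rcons_inj[zE mE]]//|[zE mE]].
  by rewrite zE -mE.
exists (A1 `|` A2); first exact: measurableU.
move=> w; rewrite msgsS running_msgs.
have -> : (A1 `|` A2) (hist Y t.+1 w) = (A1 (hist Y t.+1 w) \/ A2 (hist Y t.+1 w)) by [].
rewrite -A1E -A2E; case: ifP => /= h; split.
- by right.
- by case=> -[hz //]; rewrite hz in h.
- by left; rewrite (negbFE h).
- by case=> -[hz //]; rewrite h in hz.
Qed.

End history_events.

Lemma measurable_hist d (T : measurableType d) d' (S : measurableType d')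
    (Y : nat -> T -> S) t :
  (forall s, measurable_fun setT (Y s)) -> measurable_fun setT (hist Y t).
Proof.
move=> mY; apply/measurable_fun_tnthP => i.
by rewrite (_ : _ \o _ = Y i.+1) //; apply/funext => w /=; rewrite tnth_mktuple.
Qed.

(** * Joint law of hypothesis, messages and observations *)

Section joint_law.
Context {R : realType} {d} {T : measurableType d} {P : probability T R}
  {d1} {S1 : measurableType d1} {d2} {S2 : measurableType d2}
  {H : {RV P >-> bool}} {Y1 : nat -> {RV P >-> S1}} {Y2 : nat -> {RV P >-> S2}}
  {mu2 : nat -> {sigma_finite_measure set S2 -> \bar R}}
  {f2 : nat -> bool -> S2 -> R} {g1 : policy1 S1}.
Hypothesis Hdens2 : has_cond_density H Y2 mu2 f2.
Hypothesis Hindep2 : cond_indep_over_time H Y2.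
Hypothesis Hindep12 : cond_indep_seqs H Y1 Y2.
Hypothesis Hg1 : measurable_policy1 g1.

Let mY2 t : measurable_fun setT (Y2 t). Proof. by []. Qed.

Definition hyp_event h : set T := H @^-1` [set h].
Definition msgs_event t z : set T := msgs Y1 g1 t @^-1` [set z].
Definition hist_event t (A : set (t.-tuple S2)) : set T := hist Y2 t @^-1` A.

Lemma measurable_hyp_event h : measurable (hyp_event h).
Proof. by rewrite -[hyp_event h]setTI; exact: (measurable_funP H). Qed.

Lemma measurable_hist_event t A : measurable A -> measurable (@hist_event t A).
Proof.
by move=> mA; rewrite -[hist_event _]setTI; apply: (measurable_hist (Y := Y2)).
Qed.

Lemma msgs_eventP t z :
  exists2 A : set (t.-tuple S1), measurable A & msgs_event t z = hist Y1 t @^-1` A.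
Proof.
have [A mA AE] := msgs_hist_event Y1 t z Hg1.
by exists A => //; apply/seteqP; split => w /AE.
Qed.

Lemma measurable_msgs_event t z : measurable (msgs_event t z).
Proof.
have [A mA ->] := msgs_eventP t z.
by rewrite -[_ @^-1` _]setTI; apply: (measurable_hist (Y := Y1)).
Qed.

Lemma f2_ge0 t h y : 0 <= f2 t.+1 h y.
Proof. by have [] := Hdens2 h (ltn0Sn t). Qed.

Lemma measurable_f2 t h : measurable_fun setT (f2 t.+1 h).
Proof. by have [] := Hdens2 h (ltn0Sn t). Qed.

Lemma integral_f2 t h : (\int[mu2 t.+1]_y (f2 t.+1 h y)%:E = 1)%E.
Proof. by have [] := Hdens2 h (ltn0Sn t). Qed.

Definition lik h t (y : t.-tuple S2) : R := likelihood (fun s => f2 s h) y.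

Definition weight t h z : R := fine (P (hyp_event h `&` msgs_event t z)).

Lemma weightE t h z :
  P (hyp_event h `&` msgs_event t z) = (weight t h z)%:E.
Proof.
rewrite fineK // fin_num_measure //; apply: measurableI.
  exact: measurable_hyp_event.
exact: measurable_msgs_event.
Qed.

Lemma weight_ge0 t h z : 0 <= weight t h z.
Proof. by rewrite fine_ge0. Qed.

Lemma measure_cprob E F : measurable E -> measurable F -> P F != 0%E ->
  (P (E `&` F) = (cprob P E F)%:E * P F)%E.
Proof.
move=> mE mF PF0.
have EFfin : P (E `&` F) \is a fin_num by rewrite fin_num_measure //; exact: measurableI.
have Ffin : P F \is a fin_num by rewrite fin_num_measure.
rewrite /cprob -[P F in RHS](fineK Ffin) -EFinM divfK ?fineK //.
by rewrite fine_eq0.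
Qed.

Lemma lik_ge0 h t (y : t.-tuple S2) : 0 <= lik h y.
Proof. by apply: likelihood_ge0 => s ?; exact: f2_ge0. Qed.

Lemma measurable_lik h t : measurable_fun setT (@lik h t).
Proof. by apply: measurable_likelihood => s; exact: measurable_f2. Qed.

(** Both sides are measures in A and the left one is finite, so it is enough to compare
them on boxes, where this is independence over time. *)
Lemma hist_law h t (A : set (t.-tuple S2)) : measurable A ->
  P (hyp_event h) != 0%E ->
  (P (hyp_event h `&` hist_event A) =
   P (hyp_event h) * \int[tuple_measure mu2 t]_(y in A) (lik h y)%:E)%E.
Proof.
move=> mA h0.
have mH := measurable_hyp_event h.
have lik0 (y : t.-tuple S2) : (0 <= (lik h y)%:E)%E by rewrite lee_fin lik_ge0.
have mlik : measurable_fun setT (fun y : t.-tuple S2 => (lik h y)%:E).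
  by apply/measurable_EFinP; exact: measurable_lik.
have [nu [nuE _]] := event_law P mH (measurable_hist (t := t) mY2).
have gm0 (y : t.-tuple S2) : (0 <= P (hyp_event h) * (lik h y)%:E)%E by rewrite mule_ge0.
have mg : measurable_fun setT (fun y : t.-tuple S2 => (P (hyp_event h) * (lik h y)%:E)%E).
  exact: measurable_funeM.
have [m mE] := density_measure (tuple_measure mu2 t) gm0 mg.
rewrite -nuE // -ge0_integralZl //; last exact: measurable_funTS.
rewrite -mE; apply: eq_measure_box => //.
  by rewrite -ge0_fin_numE // fin_num_measure.
move=> B mB; transitivity (P (hyp_event h `&` hist_event (box B t))).
  exact: (nuE _ (measurable_box mB)).
rewrite mE ge0_integralZl //; last 2 first.
  exact: measurable_box.
  exact: measurable_funTS.
have mYB s : measurable (Y2 s @^-1` B s).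
  by rewrite -[_ @^-1` _]setTI; exact: mY2.
rewrite (@integral_likelihood_box _ _ _ _ _ _ _ B
   (fun s => cprob P (Y2 s @^-1` B s) (hyp_event h))) //.
- rewrite -Hindep2 // muleC -measure_cprob //; last first.
    by apply: bigcap_measurableType => s _; exact: mYB.
  rewrite setIC; congr (P (_ `&` _)); apply/seteqP; split=> w /= hw.
    move=> s /andP[s0 st].
    have sE : (s.-1 < t)%N by rewrite prednK.
    by have := hw (Ordinal sE); rewrite /= tnth_mktuple /= prednK.
  by move=> i; rewrite tnth_mktuple; apply: hw; rewrite /= ltn_ord.
- by move=> s y; exact: f2_ge0.
- by move=> s; exact: measurable_f2.
- by move=> s; have [_ _ _ /(_ h0) ->] := Hdens2 h (ltn0Sn s).
Qed.

(** The messages are a function of the observations of O1, hence independent of the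
observations of O2 given H.  When P(H = h) = 0 both sides vanish. *)
Lemma joint_law h t z (A : set (t.-tuple S2)) : measurable A ->
  (P (hyp_event h `&` (hist_event A `&` msgs_event t z)) =
   (weight t h z)%:E * \int[tuple_measure mu2 t]_(y in A) (lik h y)%:E)%E.
Proof.
move=> mA; rewrite -weightE.
have mH := measurable_hyp_event h; have mM := measurable_msgs_event t z.
have mE := measurable_hist_event mA.
have [h0|h0] := eqVneq (P (hyp_event h)) 0%E.
  have sub0 B : measurable B -> P (hyp_event h `&` B) = 0%E.
    move=> mB; apply/eqP; rewrite eq_le measure_ge0 andbT -h0.
    by rewrite le_measure ?inE //; exact: measurableI.
  by rewrite !sub0 ?mul0e //; exact: measurableI.
have [A1 mA1 ME] := msgs_eventP t z.
rewrite setIC measure_cprob //; last exact: measurableI.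
rewrite [hist_event A `&` _]setIC ME Hindep12 // EFinM -ME.
rewrite [hyp_event h `&` _]setIC measure_cprob //.
have := hist_law mA h0; rewrite setIC measure_cprob // => E.
by rewrite -muleA E muleA.
Qed.

Lemma event_measure t h (E : set T) (B : seq (option bool) -> set (t.-tuple S2)) :
  measurable E -> (forall z, measurable (B z)) ->
  (forall w, E w <-> B (msgs Y1 g1 t w) (hist Y2 t w)) ->
  (P (hyp_event h `&` E) = \sum_(z : t.-bseq (option bool))
     (weight t h z)%:E * \int[tuple_measure mu2 t]_(y in B z) (lik h y)%:E)%E.
Proof.
move=> mE mB EB.
pose F (z : t.-bseq (option bool)) := hyp_event h `&` (hist_event (B z) `&` msgs_event t z).
have mF z : measurable (F z).
  apply: measurableI; first exact: measurable_hyp_event.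
  by apply: measurableI; [exact: measurable_hist_event|exact: measurable_msgs_event].
have EF : hyp_event h `&` E = \big[setU/set0]_(z <- index_enum _) F z.
  rewrite -bigcup_seq; apply/seteqP; split => [w [hw /EB Ew]|w [z _ [hw [zB zE]]]].
    exists (Bseq (size_msgs Y1 g1 t w)); first by rewrite /= mem_index_enum.
    by split.
  by split => //; apply/EB; move: zB; rewrite /hist_event /= zE.
have mbig : measurable (\big[setU/set0]_(z <- index_enum _) F z).
  by rewrite -bigcup_seq; apply: fin_bigcup_measurable.
rewrite EF -[LHS]mul1e -integral_cst // ge0_integral_bigsetU //; last first.
  apply/trivIsetP => z z' _ _ zz'; apply/seteqP; split => // w.
  move=> [[_ [_ zE]] [_ [_ z'E]]]; move: zz'; rewrite (_ : z = z') ?eqxx //.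
  by apply: val_inj; rewrite /= -zE.
  exact: index_enum_uniq.
apply: eq_bigr => z _; rewrite integral_cst // mul1e.
exact: joint_law.
Qed.

Lemma weight_sum t h z : (size z <= t)%N ->
  \sum_(z' : t.+1.-bseq (option bool) | take t z' == z) weight t.+1 h z'
  = weight t h z.
Proof.
move=> szt; apply/eqP; rewrite -eqe -sumEFin -weightE; apply/eqP.
pose B z' : set (t.+1.-tuple S2) := if take t z' == z then setT else set0.
rewrite (@event_measure t.+1 h _ B) //.
- rewrite big_mkcond /=; apply: eq_bigr => z' _; rewrite /B; case: ifP => _.
    by have := @joint_law h t.+1 z' setT measurableT; rewrite /hist_event preimage_setT setTI weightE.
  by rewrite integral_set0 mule0.
- exact: measurable_msgs_event.
- by move=> z'; rewrite /B; case: ifP.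
- move=> w; rewrite /B take_msgs /msgs_event /=; split => [->|]; first by rewrite eqxx.
  by case: ifP => // /eqP ->.
Qed.

(** The conditional probability of history z' given its first t messages and H = h.
On histories of probability zero the value is that of a chain that stays where it
is, so that the sum over successors is always one. *)
Definition rho t h z' : R :=
  if weight t h (take t z') == 0 then (z' == take t z')%:R
  else weight t.+1 h z' / weight t h (take t z').

Lemma rho_ge0 t h z' : 0 <= rho t h z'.
Proof. by rewrite /rho; case: ifP => // _; rewrite divr_ge0 // weight_ge0. Qed.

Lemma rho_sum t h z : (size z <= t)%N ->
  \sum_(z' : t.+1.-bseq (option bool) | take t z' == z) rho t h z' = 1.
Proof.
move=> szt; have [w0|wN0] := eqVneq (weight t h z) 0.
  rewrite (eq_bigr (fun z' : t.+1.-bseq (option bool) => (val z' == z)%:R)); last first.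
    by move=> z' /eqP zE; rewrite /rho zE w0 eqxx.
  have szt1 : (size z <= t.+1)%N by exact: leqW.
  rewrite (bigD1 (Bseq szt1)) /=; last by rewrite take_oversize.
  rewrite eqxx big1 ?addr0 // => z' /andP[_ z'N].
  by rewrite (_ : (val z' == z) = false) //; apply: contraNF z'N => /eqP h'; apply/eqP/val_inj.
rewrite (eq_bigr (fun z' : t.+1.-bseq (option bool) => weight t.+1 h z' / weight t h z)).
  by rewrite -mulr_suml weight_sum // divff.
by move=> z' /eqP zE; rewrite /rho zE (negbTE wN0).
Qed.

Lemma weight_rho t h (z' : t.+1.-bseq (option bool)) :
  weight t h (take t z') * rho t h z' = weight t.+1 h z'.
Proof.
rewrite /rho; case: eqVneq => [w0|wN0]; last by rewrite mulrC divfK.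
have szt : (size (take t z') <= t)%N by rewrite size_take; case: ltnP.
have := weight_sum h szt; rewrite w0 mul0r => /eqP.
rewrite psumr_eq0 => [/allP /(_ z' (mem_index_enum _))|? _]; last exact: weight_ge0.
by rewrite eqxx => /eqP.
Qed.

(** * Cost of a policy of O2, stage by stage *)

Section policy.
Variables (c2 : R) (J : bool -> bool -> R).
Hypothesis c2_ge0 : 0 <= c2.
Hypothesis J_ge0 : forall u h, 0 <= J u h.

Let regular := @regular_cost R (option bool).
Let cont v := @cont_cost R (option bool) _ _ mu2 f2 rho c2 v.

Definition joint_lik t h z (y : t.-tuple S2) : R := weight t h z * lik h y.

Definition cost_at (v : nat -> seq (option bool) -> R -> R -> \bar R) t z
    (y : t.-tuple S2) : \bar R :=
  v t z (joint_lik false z y) (joint_lik true z y).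

Definition mass t z (y : t.-tuple S2) : R :=
  joint_lik false z y + joint_lik true z y.

Lemma joint_lik_ge0 t h z (y : t.-tuple S2) : 0 <= joint_lik h z y.
Proof. by rewrite mulr_ge0 ?weight_ge0 ?lik_ge0. Qed.

Lemma measurable_joint_lik t h z : measurable_fun setT (@joint_lik t h z).
Proof. by apply: measurable_funM => //; exact: measurable_lik. Qed.

Lemma measurable_cost_at v t z : regular v -> measurable_fun setT (@cost_at v t z).
Proof.
move=> rv; have mp : measurable_fun setT (fun y : t.-tuple S2 =>
    (joint_lik false z y, joint_lik true z y)).
  by apply/measurable_fun_pair; exact: measurable_joint_lik.
exact: (measurableT_comp (rv t z).1 mp).
Qed.

Lemma cost_at_ge0 v t z (y : t.-tuple S2) : regular v -> (0 <= cost_at v z y)%E.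
Proof. by move=> rv; have [_ [v0 _ _]] := rv t z; exact: v0. Qed.

(** The expected cost of one more step: c2 on the event of going on, and then v at the new
masses.  Because [weight_rho] composes the weights, this is Tonelli's theorem for the
reference measure on t.+1-tuples. *)
Lemma integral_cont_cost (v : nat -> seq (option bool) -> R -> R -> \bar R) t
    (N : seq (option bool) -> set (t.-tuple S2)) :
  regular v -> (forall z, measurable (N z)) ->
  (\sum_(z : t.-bseq (option bool)) \int[tuple_measure mu2 t]_(y in N z)
     cost_at (cont v) z y =
   \sum_(z : t.-bseq (option bool)) \int[tuple_measure mu2 t]_(y in N z)
     (c2%:E * (mass z y)%:E) +
   \sum_(z : t.+1.-bseq (option bool))
     \int[tuple_measure mu2 t.+1]_(y in (@tuple_init _ S2 t) @^-1` N (take t z))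
       cost_at v z y)%E.
Proof.
move=> rv mN.
have szt (z : t.+1.-bseq (option bool)) : (size (take t z) <= t)%N.
  by rewrite size_take; case: ltnP.
pose par (z : t.+1.-bseq (option bool)) : t.-bseq (option bool) := Bseq (szt z).
rewrite [X in (_ + X)%E](partition_big par xpredT) //= -big_split /=.
apply: eq_bigr => z _.
pose I z' (y : t.-tuple S2) := (\int[mu2 t.+1]_s branch f2 rho v t z'
   (joint_lik false z y) (joint_lik true z y) s)%E.
have rv0 z' a b : (0 <= v t.+1 z' a b)%E by have [_ [v0 _ _]] := rv t.+1 z'; exact: v0.
have I0 z' y : (0 <= I z' y)%E by apply: integral_ge0 => s _; exact: rv0.
have mI z' : measurable_fun setT (I z').
  have mp : measurable_fun setT (fun y : t.-tuple S2 =>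
     (joint_lik false z y, joint_lik true z y)).
    by apply/measurable_fun_pair; exact: measurable_joint_lik.
  have mb := measurable_branch2 rho measurable_f2 t z' rv.
  have mF := @measurable_fun_fubini_tonelli_F _ _ _ _ _ (mu2 t.+1) _ mb
    (fun q => rv0 z' _ _).
  exact: (measurableT_comp mF mp).
transitivity (\int[tuple_measure mu2 t]_(y in N z) (c2%:E * (mass z y)%:E +
    \sum_(z' : t.+1.-bseq (option bool) | take t z' == z) I z' y))%E.
  by apply: eq_integral => y _; rewrite /cost_at /cont /cont_cost !ger0_norm //
    joint_lik_ge0.
rewrite ge0_integralD //; last 4 first.
- by move=> y _; rewrite mule_ge0 // lee_fin addr_ge0 // joint_lik_ge0.
- apply: measurable_funTS; apply: measurable_funeM; apply/measurable_EFinP.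
  by apply: measurable_funD; exact: measurable_joint_lik.
- by move=> y _; apply: sume_ge0 => z' _; exact: I0.
- by apply: measurable_funTS; apply: emeasurable_sum_cond => z'; exact: mI.
congr (_ + _)%E.
have mIN z' : measurable_fun (N z) (I z') by apply: measurable_funTS; exact: mI.
transitivity (\int[tuple_measure mu2 t]_(y in N z)
    \sum_(z' <- [seq z' : t.+1.-bseq (option bool) <- index_enum _ | take t z' == z])
      I z' y)%E.
  by apply: eq_integral => y _; rewrite big_filter.
rewrite ge0_integral_sum //.
rewrite big_filter; apply: eq_big => [z'|z' /eqP zE].
  by rewrite -val_eqE.
rewrite zE integral_tuple_measureS //; last 2 first.
- exact: measurable_cost_at.
- by move=> y; exact: cost_at_ge0.
apply: eq_integral => y _; apply: eq_integral => s _; rewrite /branch /cost_at.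
congr (v _ _ _ _); rewrite /joint_lik /lik likelihood_rcons -weight_rho zE;
  by rewrite [LHS]mulrACA.
Qed.

Lemma integral_joint_lik t (E : set T) (B : seq (option bool) -> set (t.-tuple S2)) p q :
  measurable E -> (forall z, measurable (B z)) ->
  (forall w, E w <-> B (msgs Y1 g1 t w) (hist Y2 t w)) -> 0 <= p -> 0 <= q ->
  (\sum_(z : t.-bseq (option bool)) \int[tuple_measure mu2 t]_(y in B z)
     (joint_lik false z y * p + joint_lik true z y * q)%:E =
   p%:E * P (hyp_event false `&` E) + q%:E * P (hyp_event true `&` E))%E.
Proof.
move=> mE mB EB p0 q0; rewrite !(event_measure _ mE mB EB).
rewrite !ge0_sume_distrr; last 2 first.
- move=> z _; rewrite mule_ge0 ?lee_fin ?weight_ge0 //.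
  by apply: integral_ge0 => y _; rewrite lee_fin lik_ge0.
- move=> z _; rewrite mule_ge0 ?lee_fin ?weight_ge0 //.
  by apply: integral_ge0 => y _; rewrite lee_fin lik_ge0.
rewrite -big_split /=; apply: eq_bigr => z _.
have scale h r : 0 <= r -> (r%:E * ((weight t h z)%:E *
    \int[tuple_measure mu2 t]_(y in B z) (lik h y)%:E) =
    \int[tuple_measure mu2 t]_(y in B z) (joint_lik h z y * r)%:E)%E.
  move=> r0; rewrite muleA -EFinM -ge0_integralZl_EFin //; last 3 first.
  - by move=> y _; rewrite lee_fin lik_ge0.
  - by apply: measurable_funTS; apply/measurable_EFinP; exact: measurable_lik.
  - by rewrite mulr_ge0 ?weight_ge0.
  apply: eq_integral => y _; rewrite -EFinM /joint_lik; congr EFin.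
  by ring.
rewrite !scale // -ge0_integralD //.
- by move=> y _; rewrite lee_fin mulr_ge0 ?joint_lik_ge0.
- by apply: measurable_funTS; apply/measurable_EFinP; apply: measurable_funM => //;
    exact: measurable_joint_lik.
- by move=> y _; rewrite lee_fin mulr_ge0 ?joint_lik_ge0.
- by apply: measurable_funTS; apply/measurable_EFinP; apply: measurable_funM => //;
    exact: measurable_joint_lik.
Qed.

Lemma hyp_event_split E : measurable E ->
  (P (hyp_event false `&` E) + P (hyp_event true `&` E) = P E)%E.
Proof.
move=> mE; rewrite -measureU.
- congr (P _); rewrite -setIUl (_ : _ `|` _ = setT) ?setTI //.
  by apply/seteqP; split => // w _; rewrite /hyp_event /=; case: (H w); [right|left].
- by apply: measurableI => //; exact: measurable_hyp_event.
- by apply: measurableI => //; exact: measurable_hyp_event.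
- apply/seteqP; split => // w [[h0 _] [h1 _]]; move: h0.
  by rewrite /hyp_event /= h1.
Qed.

Variable g2 : policy2 S2.
Hypothesis Hg2 : measurable_policy2 g2.

Definition running2 t w := running (fun s => act2 Y1 Y2 g1 g2 s w) t.

Definition running_event t : set T := [set w | running2 t w].

Definition stop_event t u : set T :=
  [set w | running2 t w /\ act2 Y1 Y2 g1 g2 t.+1 w = Some u].

(** In terms of the observations and messages, the event of not having stopped by time t. *)
Fixpoint cont_set t : seq (option bool) -> set (t.-tuple S2) :=
  if t is t'.+1 then fun z => (@tuple_init _ S2 t') @^-1` cont_set (take t' z) `&`
    [set y | g2 y z = None]
  else fun _ => setT.

Definition stop_set t u z : set (t.+1.-tuple S2) :=
  (@tuple_init _ S2 t) @^-1` cont_set (take t z) `&` [set y | g2 y z = Some u].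

Arguments stop_set t u z _ : clear implicits.

Lemma running_cont_set t w :
  running_event t w <-> cont_set (msgs Y1 g1 t w) (hist Y2 t w).
Proof.
rewrite /running_event /=; elim: t => [//|t IH].
rewrite /running2 runningS /= take_msgs tuple_init_hist.
split => [/andP[/IH ? /eqP ?]//|[/IH rt gN]].
by apply/andP; split => //; apply/eqP.
Qed.

Lemma stop_event_set t u w :
  stop_event t u w <-> stop_set t u (msgs Y1 g1 t.+1 w) (hist Y2 t.+1 w).
Proof.
rewrite /stop_event /stop_set /= take_msgs tuple_init_hist.
by split=> -[/running_cont_set].
Qed.

Lemma measurable_init t (A : set (t.-tuple S2)) : measurable A ->
  measurable ((@tuple_init _ S2 t) @^-1` A).
Proof.
by move=> mA; rewrite -[_ @^-1` _]setTI; exact: measurable_tuple_init.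
Qed.

Lemma measurable_cont_set t z : measurable (@cont_set t z).
Proof.
elim: t z => [|t IH] z //=; apply: measurableI; first exact: measurable_init.
exact: Hg2.
Qed.

Lemma measurable_stop_set t u z : measurable (stop_set t u z).
Proof.
apply: measurableI; last exact: Hg2.
by apply: measurable_init; exact: measurable_cont_set.
Qed.

Lemma measurable_msgs_hist t (E : set T) (B : seq (option bool) -> set (t.-tuple S2)) :
  (forall z, measurable (B z)) ->
  (forall w, E w <-> B (msgs Y1 g1 t w) (hist Y2 t w)) -> measurable E.
Proof.
move=> mB EB; rewrite (_ : E = \bigcup_(z in [set: seq (option bool)])
    (hist_event (B z) `&` msgs_event t z)).
  apply: countable_bigcupT_measurable => [|z]; first exact: countableP.
  by apply: measurableI; [exact: measurable_hist_event|exact: measurable_msgs_event].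
apply/seteqP; split => [w /EB Bw|w [z _ [Bw zE]]].
  by exists (msgs Y1 g1 t w).
by apply/EB; move: Bw; rewrite /hist_event /= zE.
Qed.

Lemma measurable_running_event t : measurable (running_event t).
Proof.
apply: (measurable_msgs_hist (B := @cont_set t)) => [z|w].
  exact: measurable_cont_set.
exact: running_cont_set.
Qed.

Lemma measurable_stop_event t u : measurable (stop_event t u).
Proof.
apply: (measurable_msgs_hist (B := stop_set t u)) => [z|w].
  exact: measurable_stop_set.
exact: stop_event_set.
Qed.

(** The expected cost of observing at time t.+1, and of stopping then. *)
Definition mean_stage_cost t : \bar R := (c2%:E * P (running_event t) +
  \sum_(u : bool) ((J u false)%:E * P (hyp_event false `&` stop_event t u) +
                   (J u true)%:E * P (hyp_event true `&` stop_event t u)))%E.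

(** Expected costs on the event of not having stopped: [continue_cost] is evaluated at time t
after the decision to go on, [next_cost] at time t.+1 after the policy has decided. *)
Definition continue_cost v t : \bar R :=
  (\sum_(z : t.-bseq (option bool))
     \int[tuple_measure mu2 t]_(y in cont_set z) cost_at (cont v) z y)%E.

Definition next_cost v t : \bar R :=
  (\sum_(z : t.+1.-bseq (option bool))
     \int[tuple_measure mu2 t.+1]_(y in cont_set z) cost_at v z y)%E.

Lemma continue_cost_split v t : regular v ->
  continue_cost v t = (c2%:E * P (running_event t) +
    (\sum_(u : bool) \sum_(z : t.+1.-bseq (option bool))
       \int[tuple_measure mu2 t.+1]_(y in stop_set t u z) cost_at v z y +
     next_cost v t))%E.
Proof.
move=> rv; rewrite /continue_cost integral_cont_cost //; last exact: measurable_cont_set.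
congr (_ + _)%E.
  rewrite -(hyp_event_split (measurable_running_event t)) ge0_muleDr //.
  rewrite -(integral_joint_lik (measurable_running_event t) (measurable_cont_set (t := t))) //;
    last exact: running_cont_set.
  apply: eq_bigr => z _; apply: eq_integral => y _.
  by rewrite -EFinM; congr EFin; rewrite /mass; ring.
rewrite exchange_big -big_split /=; apply: eq_bigr => z _.
have mc := @measurable_cost_at v t.+1 z rv.
have c0 (y : t.+1.-tuple S2) : (0 <= cost_at v z y)%E by exact: cost_at_ge0.
have initE : (@tuple_init _ S2 t) @^-1` cont_set (take t z) =
    (stop_set t true z `|` stop_set t false z) `|` @cont_set t.+1 z.
  apply/seteqP; split => y /=.
    by move=> Ny; case g: (g2 y z) => [[]|]; [left; left|left; right|right].
  by move=> [[]|] [].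
have mst u := measurable_stop_set u z (t := t).
rewrite big_bool [in LHS]initE ge0_integral_setU //; last 4 first.
- exact: measurableU.
- exact: (@measurable_cont_set t.+1).
- exact: measurable_funTS.
- apply/disj_setPS => y [[[_ h1]|[_ h1]] [_ h2]];
  by rewrite /= in h1 h2; rewrite h1 in h2.
congr (_ + _)%E; rewrite ge0_integral_setU //.
- exact: measurable_funTS.
- apply/disj_setPS => y [[_ h1] [_ h2]].
  by rewrite /= in h1 h2; rewrite h1 in h2.
Qed.

Lemma integral_stop_cost t u :
  (\sum_(z : t.+1.-bseq (option bool)) \int[tuple_measure mu2 t.+1]_(y in stop_set t u z)
     cost_at (fun _ _ => stop_cost J u) z y =
   (J u false)%:E * P (hyp_event false `&` stop_event t u) +
   (J u true)%:E * P (hyp_event true `&` stop_event t u))%E.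
Proof.
rewrite -(integral_joint_lik (measurable_stop_event t u) (measurable_stop_set (t := t) u)) //;
  last exact: stop_event_set.
apply: eq_bigr => z _; apply: eq_integral => y _.
by rewrite /cost_at stop_costE ?joint_lik_ge0.
Qed.

Lemma regular_stop_cost u : regular (fun _ _ => stop_cost J u).
Proof.
move=> t z; split; last exact: superlinear_stop.
by apply/measurable_EFinP; apply: measurable_funD;
  apply: measurable_funM => //; apply: measurableT_comp.
Qed.

Lemma continue_cost_le_stage_next v t : regular v ->
  (forall u z a b, v t.+1 z a b <= stop_cost J u a b)%E ->
  (continue_cost v t <= mean_stage_cost t + next_cost v t)%E.
Proof.
move=> rv vle; rewrite continue_cost_split // /mean_stage_cost -addeA leeD2l // leeD2r //.
apply: lee_sum => u _; rewrite -integral_stop_cost; apply: lee_sum => z _.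
apply: ge0_le_integral => //.
- exact: measurable_stop_set.
- by move=> y _; exact: cost_at_ge0.
- by apply: measurable_funTS; exact: measurable_cost_at.
- apply: measurable_funTS; apply: measurable_cost_at; exact: regular_stop_cost.
- by move=> y _; exact: vle.
Qed.

Lemma next_cost_le v v' t : regular v -> regular v' ->
  (forall z a b, v t.+1 z a b <= cont v' t.+1 z a b)%E ->
  (next_cost v t <= continue_cost v' t.+1)%E.
Proof.
move=> rv rv' vle; apply: lee_sum => z _.
apply: ge0_le_integral => //.
- exact: (measurable_cont_set (t := t.+1)).
- by move=> y _; exact: cost_at_ge0.
- by apply: measurable_funTS; exact: measurable_cost_at.
- apply: measurable_funTS; apply: measurable_cost_at.
  exact: (regular_cont_cost mu2 f2_ge0 measurable_f2 rho_ge0 c2_ge0).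
- by move=> y _; exact: vle.
Qed.

Let hv n := horizon_value mu2 f2 rho c2 J n.
Let val := value mu2 f2 rho c2 J.

Let rhv n : regular (hv n).
Proof. exact: (regular_horizon_value mu2 f2_ge0 measurable_f2 rho_ge0 c2_ge0 J_ge0). Qed.

Let rval : regular val.
Proof. exact: (regular_value mu2 f2_ge0 measurable_f2 rho_ge0 c2_ge0 J_ge0). Qed.

Let rcont v : regular v -> regular (cont v).
Proof. exact: (regular_cont_cost mu2 f2_ge0 measurable_f2 rho_ge0 c2_ge0). Qed.

Variable L : R.
Hypothesis J_le : forall u h, J u h <= L.

Let L_ge0 : 0 <= L. Proof. exact: le_trans (J_ge0 true true) (J_le _ _). Qed.

Lemma horizon_le_stop n u t z a b : (hv n t z a b <= stop_cost J u a b)%E.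
Proof.
have best : (best_stop J a b <= stop_cost J u a b)%E.
  by rewrite ge_min; case: u; rewrite lexx ?orbT.
by case: n => [//|n]; apply: le_trans best; rewrite /hv /= /bellman ge_min lexx.
Qed.

Lemma next_cost_horizon0 t :
  (next_cost (hv 0) t <= L%:E * P (running_event t.+1))%E.
Proof.
have mE := measurable_running_event t.+1.
rewrite -(hyp_event_split mE) ge0_muleDr //.
rewrite -(integral_joint_lik mE (measurable_cont_set (t := t.+1))) //;
  last exact: running_cont_set.
apply: lee_sum => z _; apply: ge0_le_integral => //.
- exact: (@measurable_cont_set t.+1).
- by move=> y _; exact: cost_at_ge0.
- by apply: measurable_funTS; exact: measurable_cost_at.
- apply: measurable_funTS; apply/measurable_EFinP; apply: measurable_funD;
    by apply: measurable_funM => //; exact: measurable_joint_lik.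
- move=> y _; rewrite /cost_at; apply: le_trans (horizon_le_stop 0 true _ _ _ _) _.
  by rewrite stop_costE ?joint_lik_ge0 // lee_fin lerD // ler_wpM2l ?joint_lik_ge0.
Qed.

(** The policy that follows g2 and, if still running at time t + n + 1, stops there at a
cost of at most L, competes in the problem with horizon n. *)
Lemma horizon_cost_le n t : (continue_cost (hv n) t <=
  \sum_(t <= k < (t + n).+1) mean_stage_cost k + L%:E * P (running_event (t + n).+1))%E.
Proof.
elim: n t => [|n IH] t.
  rewrite addn0 big_nat1; apply: le_trans (continue_cost_le_stage_next (rhv 0) _) _.
    by move=> *; exact: horizon_le_stop.
  by rewrite leeD2l // next_cost_horizon0.
apply: le_trans (continue_cost_le_stage_next (rhv n.+1) _) _.
  by move=> *; exact: horizon_le_stop.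
have lt_t : (t < (t + n.+1).+1)%N by rewrite ltnS leq_addr.
rewrite (big_ltn lt_t) -(addeA (mean_stage_cost t)) leeD2l //.
apply: (@le_trans _ _ (continue_cost (hv n) t.+1)).
  apply: next_cost_le => // z a b.
  by rewrite /hv /= /bellman ge_min lexx orbT.
by rewrite -addSnnS; exact: IH.
Qed.

Lemma value_le_horizon_cost n : (continue_cost val 0 <= continue_cost (hv n) 0)%E.
Proof.
apply: lee_sum => z _; apply: ge0_le_integral.
- exact: (@measurable_cont_set 0).
- by move=> y _; apply: cost_at_ge0; exact: rcont.
- by apply: measurable_funTS; apply: measurable_cost_at; exact: rcont.
- by apply: measurable_funTS; apply: measurable_cost_at; exact: rcont.
move=> y _; rewrite /cost_at /cont.
apply: (cont_cost_le mu2 c2 f2_ge0 measurable_f2 rho_ge0).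
- exact: rval.
- exact: rhv.
- exact: joint_lik_ge0.
- exact: joint_lik_ge0.
- by move=> *; exact: value_le.
Qed.

Lemma mean_stage_cost_ge0 t : (0 <= mean_stage_cost t)%E.
Proof.
rewrite adde_ge0 ?mule_ge0 //; apply: sume_ge0 => u _.
by rewrite adde_ge0 // mule_ge0 ?lee_fin.
Qed.

(** The probability of still running tends to 0 as the term of a convergent series. *)
Lemma value_le_policy_cost : (\sum_(0 <= k <oo) P (running_event k) < +oo)%E ->
  (continue_cost val 0 <= \sum_(0 <= k <oo) mean_stage_cost k)%E.
Proof.
move=> Pfin; apply/lee_addgt0Pr => e e0.
have Pge0 k : (0 <= P (running_event k))%E by [].
have e1 : 0 < e / (L + 1) by rewrite divr_gt0 // ltr_wpDl.
have tail0 := nneseries_tail_cvg Pfin (fun k _ => Pge0 k).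
have /fine_cvgP[tail_fin /cvgr0Pnorm_lt /(_ _ e1) tail_lt] := tail0.
have [N _ /(_ N (leqnn N)) [Nfin Nlt]] := filterI tail_fin tail_lt.
have PN : (L%:E * P (running_event N.+1) <= e%:E)%E.
  apply: (@le_trans _ _ (L%:E * (e / (L + 1))%:E)%E).
    apply: lee_wpmul2l; first by rewrite lee_fin.
    apply: (@le_trans _ _ (\sum_(N <= k <oo) P (running_event k))%E).
      apply: le_trans (nneseries_lim_ge (m := N) N.+2 (fun k _ _ => Pge0 k)).
      by rewrite big_nat_recr //= leeDr // sume_ge0.
    by rewrite -(fineK Nfin) lee_fin (le_trans (ler_norm _)) // ltW.
  rewrite -EFinM lee_fin mulrA ler_pdivrMr ?ltr_wpDl // mulrC ler_pM2l //.
  by rewrite lerDl.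
apply: le_trans (value_le_horizon_cost N) _.
apply: le_trans (horizon_cost_le N 0) _.
rewrite add0n; apply: leeD => //.
by apply: nneseries_lim_ge => k _ _; exact: mean_stage_cost_ge0.
Qed.

Lemma value_cost_fin : (continue_cost val 0 < +oo)%E.
Proof.
apply: le_lt_trans (value_le_horizon_cost 0) _.
apply: le_lt_trans (horizon_cost_le 0 0) _.
have Pfin E : measurable E -> (P E < +oo)%E.
  by move=> mE; rewrite -ge0_fin_numE // fin_num_measure.
have mrun k := measurable_running_event k.
have mhyp h u : measurable (hyp_event h `&` stop_event 0 u).
  by apply: measurableI; [exact: measurable_hyp_event|exact: measurable_stop_event].
rewrite addn0 big_nat1 lte_add_pinfty // /mean_stage_cost ?lte_add_pinfty //.
- by rewrite lte_mul_pinfty ?Pfin.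
- rewrite big_bool /= !lte_add_pinfty // lte_mul_pinfty ?lee_fin ?Pfin //.
- by rewrite lte_mul_pinfty ?Pfin.
Qed.

(** The two hypotheses say that where g2 stops, resp. goes on, this costs at most
[value]; adding them up over time bounds all partial sums. *)
Lemma policy_cost_le_value :
  (forall t u (z : t.+1.-bseq (option bool)), \int[tuple_measure mu2 t.+1]_(y in stop_set t u z)
       cost_at (fun _ _ => stop_cost J u) z y <=
     \int[tuple_measure mu2 t.+1]_(y in stop_set t u z) cost_at val z y)%E ->
  (forall t (z : t.+1.-bseq (option bool)), \int[tuple_measure mu2 t.+1]_(y in @cont_set t.+1 z)
       cost_at (cont val) z y <=
     \int[tuple_measure mu2 t.+1]_(y in @cont_set t.+1 z) cost_at val z y)%E ->
  (\sum_(0 <= k <oo) mean_stage_cost k <= continue_cost val 0)%E.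
Proof.
move=> stop_le cont_le.
have step t : (mean_stage_cost t + continue_cost val t.+1 <= continue_cost val t)%E.
  rewrite [leRHS]continue_cost_split // /mean_stage_cost -addeA leeD2l //; apply: leeD.
    apply: lee_sum => u _; rewrite -integral_stop_cost; apply: lee_sum => z _.
    exact: stop_le.
  by apply: lee_sum => z _; exact: cont_le.
have partial n t :
    (\sum_(t <= k < t + n) mean_stage_cost k + continue_cost val (t + n) <= continue_cost val t)%E.
  elim: n t => [|n IH] t; first by rewrite addn0 big_geq // add0e.
  have lt_t : (t < t + n.+1)%N by rewrite -{1}[t]addn0 ltn_add2l.
  rewrite (big_ltn lt_t) -(addeA (mean_stage_cost t)).
  by apply: le_trans (step t); rewrite leeD2l // -addSnnS IH.
apply: lime_le; first by apply: is_cvg_nneseries => k _ _; exact: mean_stage_cost_ge0.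
apply: nearW => n; apply: le_trans (partial n 0); rewrite add0n leeDl //.
apply: sume_ge0 => z _; apply: integral_ge0 => y _.
by apply: cost_at_ge0; exact: rcont.
Qed.

Lemma indic_running t w : (running2 t w)%:R = \1_(running_event t) w :> R.
Proof.
rewrite indicE; congr (nat_of_bool _)%:R.
by apply/idP/idP; rewrite inE.
Qed.

Lemma integral_tau2 : (\int[P]_w time_val R (tau2 Y1 Y2 g1 g2 w) =
  \sum_(0 <= k <oo) P (running_event k))%E.
Proof.
transitivity (\int[P]_w \sum_(0 <= k <oo) (\1_(running_event k) w)%:E)%E.
  apply: eq_integral => w _; rewrite /tau2 time_val_series.
  by apply: eq_eseriesr => k _; rewrite -indic_running.
rewrite integral_nneseries //.
- apply: eq_eseriesr => k _; rewrite integral_indic ?setIT //.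
  exact: measurable_running_event.
- move=> k; apply/measurable_EFinP; apply: measurable_indic.
  exact: measurable_running_event.
Qed.

Definition stage_cost t w : \bar R := (c2%:E * (\1_(running_event t) w)%:E +
  \sum_(u : bool) \sum_(h : bool)
     (J u h)%:E * (\1_(hyp_event h `&` stop_event t u) w)%:E)%E.

Let mstop t u h : measurable (hyp_event h `&` stop_event t u).
Proof. by apply: measurableI; [exact: measurable_hyp_event|exact: measurable_stop_event]. Qed.

Let mweighted_indic (r : R) (A : set T) : measurable A ->
  measurable_fun setT (fun w => r%:E * (\1_A w)%:E)%E.
Proof. by move=> mA; apply: measurable_funeM; apply/measurable_EFinP. Qed.

Lemma measurable_stage_cost t : measurable_fun setT (stage_cost t).
Proof.
apply: emeasurable_funD.
  by apply: mweighted_indic; exact: measurable_running_event.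
by apply: emeasurable_sum => u; apply: emeasurable_sum => h; exact: mweighted_indic.
Qed.

Lemma stage_cost_ge0 t w : (0 <= stage_cost t w)%E.
Proof.
rewrite adde_ge0 ?mule_ge0 ?lee_fin //; apply: sume_ge0 => u _.
by apply: sume_ge0 => h _; rewrite mule_ge0 ?lee_fin.
Qed.

Lemma integral_stage_cost t : (\int[P]_w stage_cost t w = mean_stage_cost t)%E.
Proof.
have weighted (r : R) (A : set T) : 0 <= r -> measurable A ->
    (\int[P]_w (r%:E * (\1_A w)%:E) = r%:E * P A)%E.
  move=> r0 mA; rewrite ge0_integralZl_EFin //; last by apply/measurable_EFinP.
  by rewrite integral_indic ?setIT.
have mrun := measurable_running_event t.
rewrite /stage_cost ge0_integralD //; last 4 first.
- by move=> w _; rewrite mule_ge0 ?lee_fin.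
- exact: mweighted_indic.
- move=> w _; apply: sume_ge0 => u _.
  by apply: sume_ge0 => h _; rewrite mule_ge0 ?lee_fin.
- by apply: emeasurable_sum => u; apply: emeasurable_sum => h; exact: mweighted_indic.
rewrite weighted // ge0_integral_sum //; last 2 first.
- by move=> u; apply: emeasurable_sum => h; exact: mweighted_indic.
- by move=> u w _; apply: sume_ge0 => h _; rewrite mule_ge0 ?lee_fin.
congr (_ + _)%E; apply: eq_bigr => u _; rewrite ge0_integral_sum //; last 2 first.
- by move=> h; exact: mweighted_indic.
- by move=> h w _; rewrite mule_ge0 ?lee_fin.
by rewrite big_bool /= !weighted // addeC.
Qed.

(** This holds also where tau2 is infinite: both sides are then infinite or, if c2 = 0,
both vanish. *)
Lemma stage_cost_series w :
  (c2%:E * time_val R (tau2 Y1 Y2 g1 g2 w) +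
   (terminal_cost Y1 Y2 J g1 g2 (H w) w)%:E = \sum_(0 <= t <oo) stage_cost t w)%E.
Proof.
rewrite /terminal_cost /tau2 terminal_series time_val_series.
rewrite -nneseriesZl //.
rewrite -nneseriesD; last 2 first.
- by move=> t _ _; rewrite mule_ge0 ?lee_fin.
- by move=> t _ _; rewrite lee_fin mulr_ge0 //; case: (act2 _ _ _ _ _ _) => //=.
apply: eq_eseriesr => t _; rewrite /stage_cost -indic_running; congr (_ + _)%E.
have memE u h : (w \in hyp_event h `&` stop_event t u) =
    [&& H w == h, running2 t w & act2 Y1 Y2 g1 g2 t.+1 w == Some u].
  apply/idP/idP; rewrite inE /hyp_event /stop_event /=.
    by move=> [-> [-> ->]]; rewrite !eqxx.
  by move=> /and3P[/eqP -> -> /eqP ->].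
rewrite !big_bool /= !indicE !memE -/(running2 t w).
case: (act2 _ _ _ _ _ _) => [[]|]; case: (H w); case: (running2 t w) => /=;
  rewrite -!EFinM -!EFinD; congr EFin; ring.
Qed.

Lemma integral_policy_cost :
  (\int[P]_w (c2%:E * time_val R (tau2 Y1 Y2 g1 g2 w) +
     (terminal_cost Y1 Y2 J g1 g2 (H w) w)%:E) = \sum_(0 <= t <oo) mean_stage_cost t)%E.
Proof.
transitivity (\int[P]_w \sum_(0 <= t <oo) stage_cost t w)%E.
  by apply: eq_integral => w _; rewrite stage_cost_series.
rewrite integral_nneseries //.
- by apply: eq_eseriesr => t _; rewrite integral_stage_cost.
- exact: measurable_stage_cost.
- by move=> t w _; exact: stage_cost_ge0.
Qed.

Lemma cost_series (c1 : R) : 0 <= c1 ->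
  cost P H Y1 Y2 c1 c2 J g1 g2 =
  (c1%:E * \int[P]_w time_val R (tau1 Y1 g1 w) + \sum_(0 <= t <oo) mean_stage_cost t)%E.
Proof.
move=> c10; rewrite /cost; under eq_integral => w _ do rewrite -addeA.
have tau1_ge0 w : (0 <= time_val R (tau1 Y1 g1 w))%E.
  by rewrite /time_val; case: (tau1 _ _ _) => [k|]; rewrite ?lee_fin // leey.
have mtau1 : measurable_fun setT (fun w => time_val R (tau1 Y1 g1 w)).
  rewrite (_ : (fun w => _) = (fun w =>
    \sum_(0 <= t <oo) (running (fun s => msg Y1 g1 s w) t)%:R%:E)%E); last first.
    by apply/funext => w; rewrite /tau1 time_val_series.
  apply: (ge0_emeasurable_sum (P := xpredT)) => [t w _ _|t _]; first by rewrite lee_fin.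
  apply/measurable_EFinP.
  have mE : measurable [set w | running (fun s => msg Y1 g1 s w) t].
    apply: (measurable_msgs_hist (t := t)
        (B := fun z => [set y | ~~ has isSome z])) => [z|w].
      have [hz|hz] := boolP (has isSome z).
        by rewrite (_ : [set _ | _] = set0) //; apply/seteqP; split.
      by rewrite (_ : [set _ | _] = setT) //; apply/seteqP; split.
    by rewrite /= running_msgs.
  rewrite (_ : (fun w => _) = \1_[set w | running (fun s => msg Y1 g1 s w) t]) //.
  apply/funext => w; rewrite indicE; congr (nat_of_bool _)%:R.
  by apply/idP/idP; rewrite inE.
rewrite ge0_integralD //.
- by rewrite integral_policy_cost ge0_integralZl_EFin.
- by move=> w _; rewrite mule_ge0.
- exact: measurable_funeM.
- move=> w _; rewrite stage_cost_series; apply: nneseries_ge0 => t _ _.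
  exact: stage_cost_ge0.
- under eq_fun do rewrite stage_cost_series.
  apply: (ge0_emeasurable_sum (P := xpredT)) => [t w _ _|t _].
    exact: stage_cost_ge0.
  exact: measurable_stage_cost.
Qed.

End policy.

(** * The belief *)

(** Bayes' formula; the value at zero mass is 0. *)
Definition bayes_belief t (y : t.-tuple S2) (z : seq (option bool)) : R :=
  joint_lik false z y / mass z y.

Lemma mass_ge0 t z (y : t.-tuple S2) : 0 <= mass z y.
Proof. by rewrite addr_ge0 ?joint_lik_ge0. Qed.

Lemma measurable_mass t z : measurable_fun setT (@mass t z).
Proof. by apply: measurable_funD; exact: measurable_joint_lik. Qed.

Lemma bayes_belief_mass t z (y : t.-tuple S2) :
  bayes_belief y z * mass z y = joint_lik false z y.
Proof.
rewrite /bayes_belief; have [m0|mN0] := eqVneq (mass z y) 0; last by rewrite divfK.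
rewrite m0 mulr0; apply/esym/eqP.
have := m0; rewrite /mass => /eqP; rewrite paddr_eq0 ?joint_lik_ge0 //.
by move=> /andP[].
Qed.

Lemma measurable_bayes_belief t z :
  measurable_fun setT (fun y : t.-tuple S2 => bayes_belief y z).
Proof.
apply: measurable_funM; first exact: measurable_joint_lik.
by apply: measurableT_comp; [exact: measurable_invr|exact: measurable_mass].
Qed.

Lemma bayes_belief_ge0 t z (y : t.-tuple S2) : 0 <= bayes_belief y z.
Proof. by rewrite divr_ge0 ?mass_ge0 ?joint_lik_ge0. Qed.

Lemma integral_joint_lik_law t h z (A : set (t.-tuple S2)) : measurable A ->
  (\int[tuple_measure mu2 t]_(y in A) (joint_lik h z y)%:E =
   P (hyp_event h `&` (hist_event A `&` msgs_event t z)))%E.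
Proof.
move=> mA; rewrite joint_law // -ge0_integralZl_EFin ?weight_ge0 //.
- by move=> y _; rewrite lee_fin lik_ge0.
- by apply: measurable_funTS; apply/measurable_EFinP; exact: measurable_lik.
Qed.

Lemma hist_mass_law t z : exists nu : {finite_measure set (t.-tuple S2) -> \bar R},
  (forall A, measurable A ->
     nu A = (\int[tuple_measure mu2 t]_(y in A) (mass z y)%:E)%E) /\
  (forall (pi : t.-tuple S2 -> R) A, measurable_fun setT pi -> measurable A ->
     \int[nu]_(y in A) (pi y)%:E =
     \int[P]_(w in hist_event A `&` msgs_event t z) (pi (hist Y2 t w))%:E)%E.
Proof.
have [nu [nuE nuI]] := event_law P (measurable_msgs_event t z)
  (measurable_hist (t := t) mY2).
exists nu; split => [A mA|pi A mpi mA].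
  have mE : measurable (hist_event A `&` msgs_event t z).
    by apply: measurableI; [exact: measurable_hist_event|exact: measurable_msgs_event].
  transitivity (P (hist_event A `&` msgs_event t z)).
    by rewrite setIC; exact: nuE.
  rewrite -(hyp_event_split mE) -!integral_joint_lik_law // -ge0_integralD //.
  - by move=> y _; rewrite lee_fin joint_lik_ge0.
  - by apply: measurable_funTS; apply/measurable_EFinP; exact: measurable_joint_lik.
  - by move=> y _; rewrite lee_fin joint_lik_ge0.
  - by apply: measurable_funTS; apply/measurable_EFinP; exact: measurable_joint_lik.
rewrite (nuI (EFin \o pi)) //; last by apply/measurable_EFinP.
by rewrite setIC.
Qed.

Lemma integral_bayes_belief t z (nu : {finite_measure set (t.-tuple S2) -> \bar R})
    (A : set (t.-tuple S2)) :
  (forall A, measurable A -> nu A =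
     (\int[tuple_measure mu2 t]_(y in A) (mass z y)%:E)%E) ->
  measurable A ->
  (\int[nu]_(y in A) (bayes_belief y z)%:E =
   P (hyp_event false `&` (hist_event A `&` msgs_event t z)))%E.
Proof.
move=> nuE mA; rewrite (integral_density _ _ nuE) //; last 4 first.
- by move=> y; rewrite lee_fin mass_ge0.
- by apply/measurable_EFinP; exact: measurable_mass.
- by move=> y; rewrite lee_fin bayes_belief_ge0.
- by apply/measurable_EFinP; exact: measurable_bayes_belief.
rewrite -integral_joint_lik_law //; apply: eq_integral => y _.
by rewrite -EFinM bayes_belief_mass.
Qed.

Lemma integral_hist_msgs (pi : forall t, t.-tuple S2 -> seq (option bool) -> R) t z
    (A : set (t.-tuple S2)) :
  (\int[P]_(w in hist_event A `&` msgs_event t z) (pi t (hist Y2 t w) (msgs Y1 g1 t w))%:E =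
   \int[P]_(w in hist_event A `&` msgs_event t z) (pi t (hist Y2 t w) z)%:E)%E.
Proof. by apply: eq_integral => w; rewrite inE => -[_ ->]. Qed.

Lemma is_belief_bayes : is_belief2 P H Y1 Y2 g1 bayes_belief.
Proof.
move=> t _ z; split => [|A mA B]; first exact: measurable_bayes_belief.
have [nu [nuE nuI]] := hist_mass_law t z.
rewrite (integral_hist_msgs bayes_belief) -(nuI (fun y => bayes_belief y z)) //; last first.
  exact: measurable_bayes_belief.
by rewrite (integral_bayes_belief nuE).
Qed.

(** Under the law of the observations on the event that the messages are z, both beliefs
have the same integral over every set.  That law has density [mass] with respect to
the reference measure. *)
Lemma belief_unique (pi2 : forall t, t.-tuple S2 -> seq (option bool) -> R) t z :
  is_belief2 P H Y1 Y2 g1 pi2 -> (0 < t)%N ->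
  {ae tuple_measure mu2 t, forall y, 0 < mass z y -> pi2 t y z = bayes_belief y z}.
Proof.
move=> bel t0; have [mpi piE] := bel t t0 z.
have [nu [nuE nuI]] := hist_mass_law t z.
have mb := @measurable_bayes_belief t z.
have ae : ae_eq nu setT (fun y => (bayes_belief y z)%:E) (fun y => (pi2 t y z)%:E).
  apply: integral_ae_eq => //.
  - apply/integrableP; split; first exact/measurable_EFinP.
    under eq_integral => y _ do rewrite gee0_abs ?lee_fin ?bayes_belief_ge0 //.
    rewrite (integral_bayes_belief nuE) // -ge0_fin_numE // fin_num_measure //.
    apply: measurableI; first exact: measurable_hyp_event.
    by apply: measurableI; [exact: measurable_hist_event|exact: measurable_msgs_event].
  - exact/measurable_EFinP.
  - move=> E _ mE; rewrite (integral_bayes_belief nuE) // (nuI (fun y => pi2 t y z)) //.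
    by rewrite -integral_hist_msgs piE.
have [N [mN N0 Nsub]] := ae.
have mass0 : ae_eq (tuple_measure mu2 t) N (fun y => (mass z y)%:E) (cst 0%E).
  apply/ae_eq_integral_abs => //.
    by apply: measurable_funTS; apply/measurable_EFinP; exact: measurable_mass.
  under eq_integral => y _ do rewrite gee0_abs ?lee_fin ?mass_ge0 //.
  by rewrite -nuE.
apply: filterS mass0 => y m0 m_gt0.
have : ~ N y by move=> /m0 [m00]; rewrite m00 ltxx in m_gt0.
by move=> /(contra_not (@Nsub y)) /contrapT /(_ I) [->].
Qed.

(** * Optimality of the threshold policy *)

Lemma threshold_optimal (c1 c2 L : R) (J : bool -> bool -> R) :
  0 <= c1 -> 0 < c2 -> (forall u h, 0 <= J u h <= L) ->
  J true true < J false true -> J false false < J true false ->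
  exists alpha beta : nat -> seq (option bool) -> R,
    (forall t z, 0 <= alpha t z /\ alpha t z <= beta t z /\ beta t z <= 1) /\
    forall pi2, is_belief2 P H Y1 Y2 g1 pi2 ->
      optimal2 P H Y1 Y2 c1 c2 J g1 (threshold_policy2 alpha beta pi2).
Proof.
move=> c1_ge0 c2_gt0 J_bd J1 J0.
have J_ge0 u h : 0 <= J u h by have /andP[] := J_bd u h.
have J_le u h : J u h <= L by have /andP[] := J_bd u h.
have c2_ge0 := ltW c2_gt0.
pose val := value mu2 f2 rho c2 J.
have rval : regular_cost val.
  exact: (regular_value mu2 f2_ge0 measurable_f2 rho_ge0 c2_ge0 J_ge0).
have rcont : regular_cost (cont_cost mu2 f2 rho c2 val).
  exact: (regular_cont_cost mu2 f2_ge0 measurable_f2 rho_ge0 c2_ge0).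
have thr tz := value_thresholds (mu := mu2) f2_ge0 measurable_f2 integral_f2 rho_ge0 rho_sum
  c2_ge0 J_ge0 tz.1 tz.2 J1 J0.
have [al /choice [be abP]] := choice thr.
exists (fun t z => al (t, z)), (fun t z => be (t, z)); split=> [t z|pi2 bel].
  by have [? [? [? _]]] := abP (t, z).
pose g2 := threshold_policy2 (fun t z => al (t, z)) (fun t z => be (t, z)) pi2.
have mg2 : measurable_policy2 g2.
  move=> t z u t0; have [mpi _] := bel t t0 z.
  have mle a : measurable [set y : t.-tuple S2 | pi2 t y z <= a].
    rewrite (_ : [set _ | _] = (fun y => pi2 t y z) @^-1` [set` `]-oo, a]]).
      by rewrite -[_ @^-1` _]setTI; exact: mpi.
    by apply/seteqP; split => y; rewrite /= in_itv.
  have mlt a : measurable [set y : t.-tuple S2 | pi2 t y z < a].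
    rewrite (_ : [set _ | _] = (fun y => pi2 t y z) @^-1` [set` `]-oo, a[]).
      by rewrite -[_ @^-1` _]setTI; exact: mpi.
    by apply/seteqP; split => y; rewrite /= in_itv.
  have mA := mle (al (t, z)); have mB := mlt (be (t, z)).
  case: u => [[]|].
  - rewrite (_ : [set _ | _] = [set y | pi2 t y z <= al (t, z)]) //.
    apply/seteqP; split => y; rewrite /g2 /threshold_policy2 /=; case: ifP => // _.
    by case: ifP.
  - rewrite (_ : [set _ | _] = ~` [set y | pi2 t y z <= al (t, z)] `&`
      ~` [set y | pi2 t y z < be (t, z)]); last first.
      apply/seteqP; split => y; rewrite /g2 /threshold_policy2 /=.
        by case: ifP => // h1; case: ifP => // h2 _; split; rewrite ?h1 ?h2.
      by move=> [/negP/negbTE -> /negP/negbTE ->].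
    by apply: measurableI; exact: measurableC.
  - rewrite (_ : [set _ | _] = ~` [set y | pi2 t y z <= al (t, z)] `&`
      [set y | pi2 t y z < be (t, z)]); last first.
      apply/seteqP; split => y; rewrite /g2 /threshold_policy2 /=.
        by case: ifP => // h1; case: ifP => // h2 _; split; rewrite ?h1 ?h2.
      by move=> [/negP/negbTE -> ->].
    by apply: measurableI => //; exact: measurableC.
have at0 v t z (y : t.-tuple S2) : regular_cost v -> mass z y = 0 ->
    cost_at v z y = 0%E.
  move=> rv /eqP; rewrite /mass paddr_eq0 ?joint_lik_ge0 // => /andP[/eqP j0 /eqP j1].
  have [_ [_ hom _]] := rv t z.
  by rewrite /cost_at j0 j1 -(mulr0 (0 : R)) hom // mul0e.
(* whatever the policy does costs at most the value; a version of the belief is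
   only known where the mass is positive, and elsewhere all costs vanish *)
have ae_le t (z : t.+1.-bseq (option bool)) :
  {ae tuple_measure mu2 t.+1, forall y, ((if g2 t.+1 y z is Some u
    then cost_at (fun _ _ => stop_cost J u) z y
    else cost_at (cont_cost mu2 f2 rho c2 val) z y) <= cost_at val z y)%E}.
  apply: filterS (belief_unique z bel (ltn0Sn t)) => y bayes.
  have [m0|m0] := eqVneq (mass z y) 0.
    case: (g2 t.+1 y z) => [u|]; rewrite !at0 //.
    exact: regular_stop_cost.
  have m_gt0 : 0 < mass z y by rewrite lt_def m0 mass_ge0.
  have szz : (size z <= t.+1)%N by exact: size_bseq.
  have [_ [_ [_ /(_ szz)]]] := abP (t.+1, (z : seq (option bool))).
  move=> /(_ _ _ (joint_lik_ge0 false z y) (joint_lik_ge0 true z y) m_gt0) /=.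
  rewrite /g2 /threshold_policy2 bayes // /bayes_belief /cost_at /mass.
  by case: ifP => // _; case: ifP.
have opt : (\sum_(0 <= k <oo) mean_stage_cost c2 J g2 k <= continue_cost c2 g2 val 0)%E.
  apply: policy_cost_le_value => // t.
    move=> u z; apply: ae_ge0_le_integral => //.
    - exact: measurable_stop_set.
    - by move=> y _; apply: cost_at_ge0; exact: regular_stop_cost.
    - by apply: measurable_funTS; apply: measurable_cost_at; exact: regular_stop_cost.
    - by move=> y _; exact: cost_at_ge0.
    - by apply: measurable_funTS; exact: measurable_cost_at.
    - by apply: filterS (ae_le t z) => y + [_ /= gu]; rewrite gu.
  move=> z; apply: ae_ge0_le_integral => //.
  - exact: (@measurable_cont_set g2 mg2 t.+1).
  - by move=> y _; exact: cost_at_ge0.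
  - by apply: measurable_funTS; exact: measurable_cost_at.
  - by move=> y _; exact: cost_at_ge0.
  - by apply: measurable_funTS; exact: measurable_cost_at.
  - by apply: filterS (ae_le t z) => y + [_ /= gu]; rewrite gu.
have val_fin : (continue_cost c2 g2 val 0 < +oo)%E.
  exact: (value_cost_fin c2_ge0 J_ge0 mg2 J_le).
have tau2_fin : (\int[P]_w time_val R (tau2 Y1 Y2 g1 g2 w) < +oo)%E.
  rewrite integral_tau2 //.
  have stage_le : (c2%:E * \sum_(0 <= k <oo) P (running_event g2 k) <=
      \sum_(0 <= k <oo) mean_stage_cost c2 J g2 k)%E.
    rewrite -nneseriesZl //; apply: lee_nneseries => k _; first by rewrite mule_ge0.
    rewrite /mean_stage_cost leeDl //; apply: sume_ge0 => u _.
    by rewrite adde_ge0 // mule_ge0 ?lee_fin.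
  have := le_lt_trans (le_trans stage_le opt) val_fin.
  by rewrite !ltey; apply: contra_neq => ->; rewrite gt0_muley ?lte_fin.
split; first by split.
move=> g2' [mg2' tau2'_fin].
rewrite (@cost_series c2 J) // (@cost_series c2 J) //.
apply: leeD => //; apply: le_trans opt _.
apply: (value_le_policy_cost c2_ge0 J_ge0 mg2' J_le).
by rewrite -integral_tau2.
Qed.

End joint_law.

Theorem theorem7 (R : realType)
    (d : measure_display) (T : measurableType d) (P : probability T R)
    (d1 : measure_display) (S1 : measurableType d1)
    (d2 : measure_display) (S2 : measurableType d2)
    (H : {RV P >-> bool})
    (Y1 : nat -> {RV P >-> S1}) (Y2 : nat -> {RV P >-> S2})
    (p0 : R)
    (mu1 : nat -> {sigma_finite_measure set S1 -> \bar R})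
    (mu2 : nat -> {sigma_finite_measure set S2 -> \bar R})
    (f1 : nat -> bool -> S1 -> R) (f2 : nat -> bool -> S2 -> R)
    (c1 c2 L : R) (J : bool -> bool -> R) (g1 : policy1 S1)
    (Hprior : P (H @^-1` [set false]) = p0%:E)
    (Hdens1 : has_cond_density H Y1 mu1 f1)
    (Hdens2 : has_cond_density H Y2 mu2 f2)
    (Hindep1 : cond_indep_over_time H Y1)
    (Hindep2 : cond_indep_over_time H Y2)
    (Hindep12 : cond_indep_seqs H Y1 Y2)
    (Hc1 : 0 < c1) (Hc2 : 0 < c2)
    (HJ : forall u h, 0 <= J u h <= L)
    (HJ1 : J true true < J false true)
    (HJ0 : J false false < J true false)
    (Hg1 : admissible1 P Y1 g1) :
  exists alpha beta : nat -> seq (option bool) -> R,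
    [/\ forall t z, 0 <= alpha t z /\ alpha t z <= beta t z /\ beta t z <= 1,
        exists pi2 : forall t : nat, t.-tuple S2 -> seq (option bool) -> R,
          is_belief2 P H Y1 Y2 g1 pi2
      & forall pi2 : forall t : nat, t.-tuple S2 -> seq (option bool) -> R,
          is_belief2 P H Y1 Y2 g1 pi2 ->
          optimal2 P H Y1 Y2 c1 c2 J g1
            (threshold_policy2 alpha beta pi2)].
Proof.
have [alpha [beta [bd opt]]] := threshold_optimal Hdens2 Hindep2 Hindep12 Hg1.1
  (ltW Hc1) Hc2 HJ HJ1 HJ0.
exists alpha, beta; split; [exact: bd| |exact: opt].
exact: (ex_intro _ _ (is_belief_bayes Hdens2 Hindep2 Hindep12 Hg1.1)).
Qed.
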